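(* Let $(W,S)$ be a finite simply-laced Coxeter system and $c$ a Coxeter element. A covering relation $wt\lessdot w$ in the right weak Bruhat order on $W$ is contracted by the $c$-Cambrian congruence $\theta_c$ (i.e. $wt\,\theta_c\,w$) if and only if it is not $c$-stable.
   Context: Simply-laced: $m(s,t)\in\{2,3\}$. $V$ has basis $\alpha_s$, symmetric form $K(\alpha_s,\alpha_s)=2$, $K(\alpha_s,\alpha_t)=-1$ if $m(s,t)=3$, $0$ otherwise; $s(v)=v-K(\alpha_s,v)\alpha_s$. $\Phi=\{w\alpha_s\}$, $\Phi^+$ positive roots, $\operatorname{inv}(w)=\Phi^+\cap w(\Phi^-)$, weak order $v\le w\iff\operatorname{inv}(v)\subseteq\operatorname{inv}(w)$; a covering $wt\lessdot w$ ($t\in S$, $\ell(wt)<\ell(w)$) is labelled by the unique $\beta\in\operatorname{inv}(w)\setminus\operatorname{inv}(wt)$. A rank-two root subsystem: subset of $\Phi$ with 2-dimensional span, stable under its reflections, maximal; non-commutative if its two simple roots are non-orthogonal (then it has positive roots $\{\alpha,\alpha+\gamma,\gamma\}$). Fix a reduced word $c=s_{\pi(1)}\cdots s_{\pi(n)}$ of the Coxeter element. Euler form $E(\alpha_{s_{\pi(i)}},\alpha_{s_{\pi(j)}})=K(\cdot,\cdot)$ if $i>j$, $1$ if $i=j$, $0$ if $i<j$; $\omega_c(\alpha,\beta)=E(\alpha,\beta)-E(\beta,\alpha)$. For non-commutative $\Psi$, order $\Psi^+=\{\beta_1,\dots,\beta_m\}$ with $\omega_c(\beta_i,\beta_j)>0$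 for $i<j$; $w$ is $c$-aligned with respect to $\Psi$ if $\operatorname{inv}(w)\cap\Psi^+$ is empty, $\{\beta_m\}$, or an initial segment. $wt\lessdot w$ with label $\beta$ is $c$-stable if $w$ is $c$-aligned with respect to every non-commutative rank-two subsystem containing $\beta$. $c$-sorting word of $w$: lexicographically first subword of $c^\infty=cc\cdots$ that is a reduced word for $w$, written $c_{K_1}\cdots c_{K_p}$; $w$ is $c$-sortable if $K_1\supseteq\cdots\supseteq K_p$. $\pi^c_\downarrow(w)$ is the largest $c$-sortable element below $w$, and $w\,\theta_c\,w'$ iff $\pi^c_\downarrow(w)=\pi^c_\downarrow(w')$. *)

(* Defs.v *)
From HB Require Import structures.
From mathcomp Require Import all_boot all_order all_fingroup all_algebra.
From mathcomp Require Import ring.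
Set Implicit Arguments.
Unset Strict Implicit.
Unset Printing Implicit Defensive.
Import Order.TTheory GRing.Theory Num.Theory.
Local Open Scope ring_scope.

(* The congruence on words generated by (i j)^(m i j) = 1.  As m i i = 1, it
   contains i i = 1, so that the quotient monoid is already the group
   < S | (s t)^m(s,t) = 1 >. *)
Inductive cox_congr (n : nat) (m : 'I_n -> 'I_n -> nat) :
  seq 'I_n -> seq 'I_n -> Prop :=
| CoxRel u v i j :
    cox_congr m (u ++ flatten (nseq (m i j) [:: i; j]) ++ v) (u ++ v)
| CoxRefl u : cox_congr m u u
| CoxSym u v : cox_congr m u v -> cox_congr m v u
| CoxTrans u v x : cox_congr m u v -> cox_congr m v x -> cox_congr m u x.

(* A Coxeter system (W, S) with W finite and S = {cox_s i | i < n}.  W being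
   finite, no m(s,t) is infinite. *)
Record coxeterSystem (W : finGroupType) (n : nat) := CoxeterSystem {
  cox_m : 'I_n -> 'I_n -> nat;
  cox_s : 'I_n -> W;
  cox_m_diag : forall i, cox_m i i = 1%N;
  cox_m_offdiag : forall i j, i != j -> (1 < cox_m i j)%N;
  cox_m_sym : forall i j, cox_m i j = cox_m j i;
  cox_gen : forall w : W, exists u : seq 'I_n, (\prod_(i <- u) cox_s i)%g = w;
  cox_pres : forall u v : seq 'I_n,
    (\prod_(i <- u) cox_s i)%g = (\prod_(i <- v) cox_s i)%g <->
    cox_congr cox_m u v
}.

Section Coxeter.
Variables (W : finGroupType) (n : nat) (C : coxeterSystem W n).
Implicit Types (u : seq 'I_n) (w : W) (i j t : 'I_n).

Definition simply_laced : Prop :=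
  forall i j, i != j -> (cox_m C i j = 2 \/ cox_m C i j = 3)%N.

Definition word_val u : W := (\prod_(i <- u) cox_s C i)%g.

Lemma word_of_some_size w :
  exists k, [exists u : k.-tuple 'I_n, word_val u == w].
Proof.
by have [u <-] := cox_gen C w; exists (size u); apply/existsP; exists (in_tuple u).
Qed.

Definition cox_length w : nat := ex_minn (word_of_some_size w).

Definition reduced u : Prop := size u = cox_length (word_val u).

Lemma reduced_word_exists w :
  exists u : (cox_length w).-tuple 'I_n, word_val u == w.
Proof. by rewrite /cox_length; case: ex_minnP => k /existsP. Qed.

Definition reduced_word w : seq 'I_n := xchoose (reduced_word_exists w).

Lemma word_val_reduced_word w : word_val (reduced_word w) = w.
Proof. exact/eqP/(xchooseP (reduced_word_exists w)). Qed.

Definition covers w t : Prop :=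
  (cox_length (w * cox_s C t)%g < cox_length w)%N.

Section GeometricRepresentation.
Variable R : realFieldType.
Local Notation V := 'rV[R]_n.
Implicit Types (x y v a b : V).

Definition simple_root i : V := delta_mx 0 i.

Definition cox_mx : 'M[R]_n := \matrix_(i, j)
  (if i == j then 2 else if cox_m C i j == 3%N then -1 else 0).

Definition form x y : R := (x *m cox_mx *m y^T) 0 0.

(* The reflection in a root a, normalised by form a a = 2. *)
Definition refl a v : V := v - form a v *: a.

Definition word_act u v : V := foldr (fun i => refl (simple_root i)) v u.

(* The value does not depend on the word chosen for w: see act_word. *)
Definition act w v : V := word_act (reduced_word w) v.

Lemma formDr x y z : form x (y + z) = form x y + form x z.
Proof. by rewrite /form linearD mulmxDr mxE. Qed.

Lemma formZr x c y : form x (c *: y) = c * form x y.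
Proof. by rewrite /form linearZ -scalemxAr mxE. Qed.

Lemma formBZr x y c z : form x (y - c *: z) = form x y - c * form x z.
Proof. by rewrite -scaleNr formDr formZr mulNr. Qed.

Lemma form_simple i j : form (simple_root i) (simple_root j) = cox_mx i j.
Proof. by rewrite /form -rowE trmx_delta -colE !mxE. Qed.

Lemma word_act_cat u1 u2 v : word_act (u1 ++ u2) v = word_act u1 (word_act u2 v).
Proof. exact: foldr_cat. Qed.

Lemma word_act_rel i j v : simply_laced ->
  word_act (flatten (nseq (cox_m C i j) [:: i; j])) v = v.
Proof.
move=> SL; have [<-|neq_ij] := eqVneq i j.
  rewrite cox_m_diag /= /refl !formBZr form_simple !mxE eqxx.
  by apply/rowP => k; rewrite !mxE; ring.
have neq_ji : (j == i) = false by rewrite eq_sym; apply/negbTE.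
have [m2|m3] := SL _ _ neq_ij.
- rewrite m2 /= /refl !formBZr !form_simple !mxE !eqxx (negbTE neq_ij) neq_ji.
  rewrite (cox_m_sym C j i) m2 /=.
  by apply/rowP => k; rewrite !mxE; ring.
- rewrite m3 /= /refl !formBZr !form_simple !mxE !eqxx (negbTE neq_ij) neq_ji.
  rewrite (cox_m_sym C j i) m3 /=.
  by apply/rowP => k; rewrite !mxE; ring.
Qed.

Lemma act_word u v : simply_laced -> act (word_val u) v = word_act u v.
Proof.
move=> SL.
have congrP u1 u2 : cox_congr (cox_m C) u1 u2 ->
    forall x, word_act u1 x = word_act u2 x.
  elim=> {u1 u2} [u1 u2 i j x|//|u1 u2 _ IH x|u1 u2 u3 _ IH1 _ IH2 x].
  - by rewrite !word_act_cat word_act_rel.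
  - by rewrite IH.
  - by rewrite IH1.
by apply: congrP; apply/cox_pres; apply: word_val_reduced_word.
Qed.

Definition roots : seq V := undup [seq act w (simple_root i) | w <- enum W, i <- enum 'I_n].

Definition pos_part (A : seq V) : seq V :=
  [seq a : V <- A | [forall i, 0 <= a 0 i]].

Definition neg_part (A : seq V) : seq V :=
  [seq a : V <- A | [forall i, a 0 i <= 0]].

Definition inv w : seq V :=
  [seq a <- pos_part roots | a \in [seq act w b | b <- neg_part roots]].

Definition weak_le w1 w2 : Prop := {subset inv w1 <= inv w2}.

Definition cover_label w t a : Prop :=
  [seq b <- inv w | b \notin inv (w * cox_s C t)%g] =i [:: a].

Definition rank2_closed (A : seq V) : Prop :=
  [/\ {subset A <= roots}, \dim <<A>>%VS = 2%N &
      {in A &, forall a b, refl a b \in A}].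

Definition rank2_subsystem (A : seq V) : Prop :=
  rank2_closed A /\
  forall B, rank2_closed B -> {subset A <= B} -> B =i A.

Definition simple_pair (A : seq V) a b : Prop :=
  [/\ a \in pos_part A, b \in pos_part A, a != b &
      {in pos_part A, forall v,
         exists x y : R, [/\ 0 <= x, 0 <= y & v = x *: a + y *: b]}].

Definition noncommutative (A : seq V) : Prop :=
  exists a b, simple_pair A a b /\ form a b != 0.

(* From here on, pi encodes the reduced word c = s_{pi 0} ... s_{pi (n-1)} of a
   Coxeter element. *)
Variable pi : 'S_n.

Definition cox_word : seq 'I_n := [seq pi i | i <- enum 'I_n].

(* The entry at (i, j) is E(alpha_i, alpha_j); pi^-1 i is the position of the
   letter i in the word. *)
Definition euler_mx : 'M[R]_n := \matrix_(i, j)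
  let k := (pi^-1)%g i in let l := (pi^-1)%g j in
  if (l < k)%N then cox_mx i j else if k == l then 1 else 0.

Definition euler x y : R := (x *m euler_mx *m y^T) 0 0.

Definition omega x y : R := euler x y - euler y x.

Definition omega_order (A b : seq V) : Prop :=
  [/\ uniq b, b =i pos_part A & pairwise (fun x y => 0 < omega x y) b].

Definition aligned w (A : seq V) : Prop :=
  exists2 b, omega_order A b &
    let I := [seq a <- inv w | a \in pos_part A] in
    [\/ I =i [::], I =i [:: last 0 b] | exists k, I =i take k b].

Definition c_stable w t : Prop :=
  exists2 a, cover_label w t a &
    forall A, rank2_subsystem A -> noncommutative A -> a \in A -> aligned w A.

End GeometricRepresentation.

Section Cambrian.
Variable pi : 'S_n.

(* The letters of c^oo = c c c ... are indexed by pairs (q, k): letter k of the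
   copy number q of c, which is letter number q * n + k of c^oo.  A subword of
   c^oo is the strictly increasing sequence of its positions. *)
Definition position (x : nat * 'I_n) : nat := (x.1 * n + x.2)%N.

Definition subword_letters (p : seq (nat * 'I_n)) : seq 'I_n :=
  [seq pi x.2 | x <- p].

Definition reduced_subword w (p : seq (nat * 'I_n)) : Prop :=
  [/\ sorted ltn (map position p), reduced (subword_letters p) &
      word_val (subword_letters p) = w].

Definition sorting_word w (p : seq (nat * 'I_n)) : Prop :=
  reduced_subword w p /\
  forall p', reduced_subword w p' ->
    ((map position p : seqlexi nat) <= (map position p' : seqlexi nat))%O.

(* The set K_{q+1} of letters taken from copy number q of c. *)
Definition sorting_block (p : seq (nat * 'I_n)) (q : nat) : {set 'I_n} :=
  [set i in subword_letters [seq x <- p | x.1 == q]].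

Definition sortable w : Prop :=
  exists2 p, sorting_word w p &
    forall q, sorting_block p q.+1 \subset sorting_block p q.

Definition largest_sortable_below (R : realFieldType) w v : Prop :=
  [/\ sortable v, weak_le R v w &
      forall v', sortable v' -> weak_le R v' w -> weak_le R v' v].

Definition cambrian_congr (R : realFieldType) w w' : Prop :=
  exists2 v, largest_sortable_below R w v & largest_sortable_below R w' v.

End Cambrian.
End Coxeter.

(* Main.v *)
Require Import Defs.
From HB Require Import structures.
From mathcomp Require Import all_boot all_order all_fingroup all_algebra.
From mathcomp Require Import zify ring lra.
Import Defs.
Set Implicit Arguments.
Unset Strict Implicit.
Unset Printing Implicit Defensive.
Import Order.TTheory GRing.Theory Num.Theory.
Local Open Scope ring_scope.

(* For a word q of distinct letters, E_q denotes the Euler form of the Coxeter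
   element q of the standard parabolic subgroup W_q, and omega_q its
   antisymmetrisation.  The largest sortable element below w is computed by
   reading q cyclically: a letter that is a left descent of what remains of w is
   taken, any other letter is discarded for good ([proj]).  When the initial
   letter s is taken, (q, w) becomes (s q s, s w) and E_(sqs)(s x, s y) = E_q(x, y),
   so that statements about [proj] are proved along this recursion.

   The key step is that the label b of a stable cover is an inversion of the
   projection v of w ([stable_label]).  The recursion is immediate unless the
   initial letter s is not a descent of w while b has a positive coordinate b_s,
   a situation that has to be excluded.  Let K be the symmetric form.
   - If K(b, a_s) = 1, then b = a_s + (b - a_s) contradicts stability.
   - If K(b, a_s) = 0, then b labels a cover of s w that is stable for s q s.
   - If K(b, a_s) = -1, one moves from the wall of s w in the direction of the
     linear form omega_(sqs)(s b, _), which is negative on all x such that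
     s b = x + y and omega_(sqs)(x, y) > 0, up to a point h that vanishes on b
     and on a_s.  By induction s b is an inversion of a projection near h, so h
     is negative on all x such that b = x + y and omega_(sqs)(x, y) > 0, and b
     labels a stable cover near h that has a_s as an inversion.
   In the last two cases b is, by induction, an inversion of the projection for
   s q s, whose final letter is s; as a_s is an inversion too, b_s <= 0.

   Conversely the inversions of a projection are aligned.  It follows that v is
   the largest sortable element below w, and that the cover is contracted if and
   only if its label is not an inversion of v. *)

(** * The action on V and the length function *)

Definition nonneg (R : realFieldType) n (x : 'rV[R]_n) : bool :=
  [forall i, 0 <= x 0 i].

Section Bilinear.
Variables (R : realFieldType) (W : finGroupType) (n : nat).
Variable C : coxeterSystem W n.
Implicit Types (x y z : 'rV[R]_n) (i j : 'I_n).
Local Notation K := (form C).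
Local Notation a_ i := (simple_root R i).
Local Notation rf i := (refl C (simple_root R i)).

Lemma simple_coord i j : (a_ i) 0 j = (j == i)%:R.
Proof. by rewrite mxE eqxx. Qed.

Lemma cox_mxC i j : cox_mx C R i j = cox_mx C R j i.
Proof. by rewrite !mxE (eq_sym i j) (cox_m_sym C i j). Qed.

Lemma formC x y : K x y = K y x.
Proof.
rewrite /form; transitivity ((x *m cox_mx C R *m y^T)^T 0 0); first by rewrite [RHS]mxE.
rewrite !trmx_mul trmxK mulmxA; congr ((_ *m _ *m _) _ _).
by apply/matrixP => i j; rewrite mxE cox_mxC.
Qed.

Lemma formDl x y z : K (x + y) z = K x z + K y z.
Proof. by rewrite formC formDr !(formC z). Qed.

Lemma formZl c x y : K (c *: x) y = c * K x y.
Proof. by rewrite formC formZr formC. Qed.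

Lemma formNr x y : K x (- y) = - K x y.
Proof. by rewrite -scaleN1r formZr mulN1r. Qed.

Lemma formNl x y : K (- x) y = - K x y.
Proof. by rewrite formC formNr formC. Qed.

Lemma form_sumr (I : finType) x (F : I -> 'rV[R]_n) :
  K x (\sum_i F i) = \sum_i K x (F i).
Proof. by rewrite /form linear_sum mulmx_sumr summxE. Qed.

Lemma row_simple x : x = \sum_i x 0 i *: a_ i.
Proof. exact: row_sum_delta. Qed.

Lemma form_coord x y : K x y = \sum_i y 0 i * K x (a_ i).
Proof.
by rewrite {1}(row_simple y) form_sumr; apply: eq_bigr => i _; rewrite formZr.
Qed.

Lemma form_simpleii i : K (a_ i) (a_ i) = 2.
Proof. by rewrite form_simple mxE eqxx. Qed.

Lemma refl_coord i x j : (rf i x) 0 j = x 0 j - K x (a_ i) * (j == i)%:R.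
Proof. by rewrite /refl !mxE eqxx formC. Qed.

Lemma refl_coord_neq i x j : j != i -> (rf i x) 0 j = x 0 j.
Proof. by move=> /negbTE ne; rewrite refl_coord ne mulr0 subr0. Qed.

Lemma refl_coord_eq i x : (rf i x) 0 i = x 0 i - K x (a_ i).
Proof. by rewrite refl_coord eqxx mulr1. Qed.

Lemma form_refl i x y : K (rf i x) (rf i y) = K x y.
Proof.
rewrite /refl !formDl !formDr !formNl !formNr !formZl !formZr form_simpleii.
rewrite (formC x (a_ i)); ring.
Qed.

Lemma reflD i x y : rf i (x + y) = rf i x + rf i y.
Proof. by rewrite /refl formDr; apply/rowP => k; rewrite !mxE; ring. Qed.

Lemma reflZ i c x : rf i (c *: x) = c *: rf i x.
Proof. by rewrite /refl formZr; apply/rowP => k; rewrite !mxE; ring. Qed.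

Lemma reflK i : involutive (rf i).
Proof.
move=> x; rewrite /refl !formBZr form_simpleii.
by apply/rowP => k; rewrite !mxE; ring.
Qed.

Lemma reflN i x : rf i (- x) = - rf i x.
Proof. by rewrite -scaleN1r reflZ scaleN1r. Qed.

Lemma refl_simple i : rf i (a_ i) = - a_ i.
Proof. by rewrite /refl form_simpleii; apply/rowP => k; rewrite !mxE; ring. Qed.

End Bilinear.

Section Action.
Variables (R : realFieldType) (W : finGroupType) (n : nat).
Variables (C : coxeterSystem W n) (HC : simply_laced C).
Implicit Types (x y z : 'rV[R]_n) (i j t : 'I_n) (u v w : W).
Local Notation K := (form C).
Local Notation a_ i := (simple_root R i).
Local Notation rf i := (refl C (simple_root R i)).
Local Notation s_ := (cox_s C).
Local Notation len := (cox_length C).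
Local Notation act := (act C).

Lemma word_val_cat p q : word_val C (p ++ q) = (word_val C p * word_val C q)%g.
Proof. by rewrite /word_val big_cat. Qed.

Lemma word_val_cons i p : word_val C (i :: p) = (s_ i * word_val C p)%g.
Proof. by rewrite /word_val big_cons. Qed.

Lemma word_val_nil : word_val C [::] = 1%g.
Proof. by rewrite /word_val big_nil. Qed.

Lemma cox_s2 i : (s_ i * s_ i = 1)%g.
Proof.
have /cox_pres : cox_congr (cox_m C) [:: i; i] [::].
  by have := CoxRel (cox_m C) [::] [::] i i; rewrite cox_m_diag.
by rewrite !big_cons big_nil mulg1.
Qed.

Lemma cox_sV i : (s_ i)^-1%g = s_ i.
Proof. by apply/eqP; rewrite eq_invg_mul cox_s2. Qed.

Lemma cox_sK i w : (s_ i * (s_ i * w) = w)%g.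
Proof. by rewrite mulgA cox_s2 mul1g. Qed.

Lemma cox_sKr i w : (w * s_ i * s_ i = w)%g.
Proof. by rewrite -mulgA cox_s2 mulg1. Qed.

Lemma cox_comm i j : cox_m C i j = 2%N -> (s_ i * s_ j = s_ j * s_ i)%g.
Proof.
move=> m2; have /cox_pres : cox_congr (cox_m C) [:: i; j; i; j] [::].
  by have := CoxRel (cox_m C) [::] [::] i j; rewrite m2.
rewrite !big_cons big_nil mulg1 => e.
by rewrite -[RHS]mulg1 -e !mulgA cox_sKr cox_s2 mul1g.
Qed.

Lemma cox_braid i j :
  cox_m C i j = 3%N -> (s_ i * s_ j * s_ i = s_ j * s_ i * s_ j)%g.
Proof.
move=> m3; have /cox_pres : cox_congr (cox_m C) [:: i; j; i; j; i; j] [::].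
  by have := CoxRel (cox_m C) [::] [::] i j; rewrite m3.
rewrite !big_cons big_nil mulg1 => e.
by rewrite -[RHS]mul1g -e !mulgA !cox_sKr.
Qed.

Lemma actM u w x : act (u * w)%g x = act u (act w x).
Proof.
rewrite -{1}(word_val_reduced_word C u) -{1}(word_val_reduced_word C w).
by rewrite -word_val_cat act_word // word_act_cat.
Qed.

Lemma act1 x : act 1%g x = x.
Proof. by rewrite -word_val_nil act_word. Qed.

Lemma act_s i x : act (s_ i) x = rf i x.
Proof. by rewrite -[s_ i]mulg1 -word_val_nil -word_val_cons act_word. Qed.

Lemma actD w x y : act w (x + y) = act w x + act w y.
Proof. by rewrite /Defs.act; elim: reduced_word => //= i p ->; rewrite reflD. Qed.

Lemma actZ w c x : act w (c *: x) = c *: act w x.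
Proof. by rewrite /Defs.act; elim: reduced_word => //= i p ->; rewrite reflZ. Qed.

Lemma actN w x : act w (- x) = - act w x.
Proof. by rewrite -scaleN1r actZ scaleN1r. Qed.

Lemma act0 w : act w (0 : 'rV[R]_n) = 0.
Proof. by have := actZ w 0 0; rewrite !scale0r. Qed.

Lemma form_act w x y : K (act w x) (act w y) = K x y.
Proof. by rewrite /Defs.act; elim: reduced_word => //= i p <-; rewrite form_refl. Qed.

Lemma actK w x : act w^-1%g (act w x) = x.
Proof. by rewrite -actM mulVg act1. Qed.

Lemma actVK w x : act w (act w^-1%g x) = x.
Proof. by rewrite -actM mulgV act1. Qed.

Lemma len_le p : (len (word_val C p) <= size p)%N.
Proof.
rewrite /cox_length; case: ex_minnP => k _; apply.
by apply/existsP; exists (in_tuple p).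
Qed.

Lemma len_word w : exists2 p, size p = len w & word_val C p = w.
Proof.
by exists (reduced_word C w); rewrite ?size_tuple ?word_val_reduced_word.
Qed.

Lemma len_mulr w i : (len (w * s_ i)%g <= (len w).+1)%N.
Proof.
have [p <- <-] := len_word w.
by rewrite -[s_ i]mulg1 -word_val_nil -word_val_cons -word_val_cat
  (leq_trans (len_le _)) // size_cat addn1.
Qed.

Lemma word_val_rev p : word_val C (rev p) = ((word_val C p)^-1)%g.
Proof.
elim: p => [|i p IH]; first by rewrite word_val_nil invg1.
by rewrite rev_cons -cats1 word_val_cat IH !word_val_cons word_val_nil mulg1
  invMg cox_sV.
Qed.

Lemma len_inv w : len w^-1%g = len w.
Proof.
have le v : (len v^-1%g <= len v)%N.
  by have [p <- <-] := len_word v; rewrite -word_val_rev -(size_rev p) len_le.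
by apply/eqP; rewrite eqn_leq le -{1}[w]invgK le.
Qed.

Lemma descent_exists w : w != 1%g -> exists t, (len (w * s_ t)%g < len w)%N.
Proof.
have [p] := len_word w; case: (lastP p) => [|q t] sz e.
  by rewrite -e word_val_nil eqxx.
exists t; rewrite -sz -e -cats1 word_val_cat word_val_cons word_val_nil mulg1.
by rewrite cox_sKr size_cat addn1 ltnS len_le.
Qed.

Lemma len1 : len 1%g = 0%N.
Proof. by apply/eqP; rewrite -leqn0 -word_val_nil len_le. Qed.

Lemma nonneg_simple i : nonneg (a_ i).
Proof. by apply/forallP => j; rewrite simple_coord ler0n. Qed.

Lemma nonnegD x y : nonneg x -> nonneg y -> nonneg (x + y).
Proof.
by move=> /forallP hx /forallP hy; apply/forallP => i; rewrite mxE addr_ge0.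
Qed.

Lemma nonnegZ c x : 0 <= c -> nonneg x -> nonneg (c *: x).
Proof.
by move=> hc /forallP hx; apply/forallP => i; rewrite mxE mulr_ge0.
Qed.

(* Humphreys, Reflection Groups and Coxeter Groups, Theorem 5.4. *)
Lemma nonneg_act_simple w i :
  (len w <= len (w * s_ i)%g)%N -> nonneg (act w (a_ i)).
Proof.
have [k] := ubnP (len w); elim: k w i => // k IH w i; rewrite ltnS => lk le.
have [->|/descent_exists [t lt]] := eqVneq w 1%g; first by rewrite act1 nonneg_simple.
have ti : i != t by apply: contraTneq lt => <-; rewrite -leqNgt.
have [v wE {}lt] : exists2 v, w = (v * s_ t)%g & (len v < len w)%N.
  by exists (w * s_ t)%g; rewrite ?cox_sKr.
have lwv : (len w <= (len v).+1)%N by rewrite wE len_mulr.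
have lv : (len v < k)%N by exact: leq_trans lt lk.
have rE (z : 'I_n) : z != t -> rf t (a_ z) = a_ z - cox_mx C R z t *: a_ t.
  by move=> _; rewrite /refl formC form_simple.
case: (HC ti) => m.
  have -> : act w (a_ i) = act v (a_ i).
    by rewrite wE actM act_s rE // mxE (negbTE ti) m scale0r subr0.
  apply: IH => //; have := len_mulr (v * s_ i)%g t.
  by rewrite -mulgA (cox_comm m) mulgA -wE => h; rewrite -ltnS (leq_trans lt) // (leq_trans le).
have ract : rf t (a_ i) = a_ i + a_ t.
  by rewrite rE // mxE (negbTE ti) m scaleN1r opprK.
have -> : act w (a_ i) = act v (a_ i) + act v (a_ t).
  by rewrite wE actM act_s ract actD.
have nvt : nonneg (act v (a_ t)) by apply: IH => //; rewrite -wE ltnW.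
have [ge|lt'] := leqP (len v) (len (v * s_ i)%g).
  by apply: nonnegD => //; apply: IH.
have [v2 vE {}lt'] : exists2 v2, v = (v2 * s_ i)%g & (len v2 < len v)%N.
  by exists (v * s_ i)%g; rewrite ?cox_sKr.
have rit : rf i (a_ t) = a_ i + a_ t.
  rewrite /refl form_simple mxE (negbTE ti) m scaleN1r opprK addrC //.
have -> : act v (a_ i) + act v (a_ t) = act v2 (a_ t).
  by rewrite -actD -rit -act_s -actM vE cox_sKr.
apply: IH; first exact: ltn_trans lv.
(* By the braid relation [w * s_ i] is at most 2 longer than [v2 * s_ t], while [w] is at least 2
   longer than [v2] and not longer than [w * s_ i]. Hence [len v2 <= len (v2 * s_ t)]. *)
have e : (w * s_ i = v2 * s_ t * s_ i * s_ t)%g.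
  by rewrite wE vE -!mulgA; congr (_ * _)%g; rewrite !mulgA cox_braid.
have l1 := len_mulr (v2 * s_ t * s_ i)%g t; have l2 := len_mulr (v2 * s_ t)%g i.
rewrite e in le; move: lt lt' le l1 l2.
move: (len v2) (len v) (len w) (len _) (len _) (len _) => *; lia.
Qed.

End Action.

(** * Roots and inversion sets *)

(** Integrality of root coordinates confines the form between non-proportional roots to -1, 0, 1 and
    yields the parity argument by which [om] does not vanish on summands of a root. *)
Definition isint (R : realFieldType) (r : R) : Prop := exists z : int, r = z%:~R.

Section Integers.
Variable R : realFieldType.
Implicit Types r : R.

Lemma isintD r1 r2 : isint r1 -> isint r2 -> isint (r1 + r2).
Proof. by move=> [z1 ->] [z2 ->]; exists (z1 + z2); rewrite rmorphD. Qed.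

Lemma isintM r1 r2 : isint r1 -> isint r2 -> isint (r1 * r2).
Proof. by move=> [z1 ->] [z2 ->]; exists (z1 * z2); rewrite rmorphM. Qed.

Lemma isintN r : isint r -> isint (- r).
Proof. by move=> [z ->]; exists (- z); rewrite rmorphN. Qed.

Lemma isint_nat m : isint (m%:R : R).
Proof. by exists m%:Z. Qed.

Lemma isint_sum (I : Type) (s : seq I) (F : I -> R) :
  (forall i, isint (F i)) -> isint (\sum_(i <- s) F i).
Proof.
move=> h; elim/big_ind: _ => //; [exact: (isint_nat 0) | exact: isintD].
Qed.

Lemma isint_ge1 r : isint r -> 0 < r -> 1 <= r.
Proof. by move=> [z ->]; rewrite ltr0z ler1z. Qed.

Lemma isint_small r : isint r -> -2 < r -> r < 2 -> [\/ r = -1, r = 0 | r = 1].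
Proof.
move=> [z ->] h1 h2.
have {}h1 : -2 < z by rewrite -(ltr_int R) rmorphN.
have {}h2 : z < 2 by rewrite -(ltr_int R).
have [->|[->|->]] : z = -1 \/ z = 0 \/ z = 1 by lia.
- by constructor 1; rewrite rmorphN.
- by constructor 2.
- by constructor 3.
Qed.

End Integers.

Section Roots.
Variables (R : realFieldType) (W : finGroupType) (n : nat).
Variables (C : coxeterSystem W n) (HC : simply_laced C).
Implicit Types (x y z : 'rV[R]_n) (i j t : 'I_n) (u v w : W).
Local Notation K := (form C).
Local Notation a_ i := (simple_root R i).
Local Notation rf i := (refl C (simple_root R i)).
Local Notation s_ := (cox_s C).
Local Notation len := (cox_length C).
Local Notation act := (act C).
Local Notation Phi := (roots C R).
Local Notation inv := (inv C R).

Definition posroot x : bool := (x \in Phi) && nonneg x.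

Lemma rootP x : reflect (exists w i, x = act w (a_ i)) (x \in Phi).
Proof.
rewrite mem_undup; apply: (iffP allpairsP).
  by move=> [[w i] [_ _ ->]]; exists w, i.
by move=> [w [i ->]]; exists (w, i); rewrite !mem_enum.
Qed.

Lemma root_simple i : a_ i \in Phi.
Proof. by apply/rootP; exists 1%g, i; rewrite act1. Qed.

Lemma root_act w x : x \in Phi -> act w x \in Phi.
Proof. by move=> /rootP [u [i ->]]; apply/rootP; exists (w * u)%g, i; rewrite actM. Qed.

Lemma root_refl i x : x \in Phi -> rf i x \in Phi.
Proof. by rewrite -act_s //; exact: root_act. Qed.

Lemma rootN x : x \in Phi -> - x \in Phi.
Proof.
move=> /rootP [u [i ->]]; apply/rootP; exists (u * s_ i)%g, i.
by rewrite actM // act_s // refl_simple actN.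
Qed.

Lemma root_norm x : x \in Phi -> K x x = 2.
Proof. by move=> /rootP [u [i ->]]; rewrite form_act form_simpleii. Qed.

Lemma root_neq0 x : x \in Phi -> x != 0.
Proof.
move=> h; apply/eqP => x0; have := root_norm h.
by rewrite x0 -(scale0r (0 : 'rV_n)) formZl mul0r => /eqP; rewrite eq_sym pnatr_eq0.
Qed.

Lemma root_sign x : x \in Phi -> nonneg x \/ nonneg (- x).
Proof.
move=> /rootP [w [i ->]]; have [h|h] := leqP (len w) (len (w * s_ i)%g).
  by left; exact: nonneg_act_simple.
right; rewrite -actN -(@refl_simple _ _ _ C) -act_s // -actM //.
by apply: nonneg_act_simple => //; rewrite cox_sKr ltnW.
Qed.

Lemma nonneg_antisym x : nonneg x -> nonneg (- x) -> x = 0.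
Proof.
move=> /forallP h1 /forallP h2; apply/rowP => i; apply/eqP; rewrite [X in _ == X]mxE eq_le h1 andbT.
by have := h2 i; rewrite mxE oppr_ge0.
Qed.

Lemma root_not_neg x : x \in Phi -> nonneg x -> ~~ nonneg (- x).
Proof. by move=> h p; apply/negP => m; have := root_neq0 h; rewrite (nonneg_antisym p m) eqxx. Qed.

Lemma root_nonnegN x : x \in Phi -> nonneg (- x) = ~~ nonneg x.
Proof.
move=> h; case: (root_sign h) => p; first by rewrite p (negbTE (root_not_neg h p)).
rewrite p; apply/esym; rewrite -[x]opprK; apply: root_not_neg => //; exact: rootN.
Qed.

Lemma posroot_simple i : posroot (a_ i).
Proof. by rewrite /posroot root_simple nonneg_simple. Qed.

Lemma posroot_root x : posroot x -> x \in Phi. Proof. by case/andP. Qed.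

Lemma posroot_ge0 x i : posroot x -> 0 <= x 0 i.
Proof. by case/andP => _ /forallP. Qed.

Lemma mem_inv x w : (x \in inv w) = posroot x && nonneg (- act w^-1%g x).
Proof.
rewrite /Defs.inv mem_filter /pos_part mem_filter andbC /posroot /nonneg.
rewrite [X in X && _]andbC; apply: andb_id2l => /andP [xr xp].
apply/mapP/idP.
  move=> [b]; rewrite /neg_part mem_filter => /andP [bn _] ->.
  by rewrite actK //; apply/forallP => i; rewrite mxE oppr_ge0 (forallP bn).
move=> h; exists (act w^-1%g x); last by rewrite actVK.
rewrite /neg_part mem_filter root_act // andbT.
by apply/forallP => i; have := forallP h i; rewrite mxE oppr_ge0.
Qed.

Lemma inv_posroot x w : x \in inv w -> posroot x.
Proof. by rewrite mem_inv => /andP []. Qed.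

Lemma notin_inv x w : posroot x -> (x \notin inv w) = nonneg (act w^-1%g x).
Proof.
move=> px; rewrite mem_inv px /= root_nonnegN ?negbK //.
by apply: root_act; exact: posroot_root.
Qed.

Lemma inv1 x : x \notin inv 1%g.
Proof.
by rewrite mem_inv invg1 act1 // andbC; apply/negP => /and3P [h1 h2 h3];
  have := root_not_neg h2 h3; rewrite h1.
Qed.

Lemma inv_add w x y : x \in inv w -> y \in inv w -> x + y \in Phi -> x + y \in inv w.
Proof.
rewrite !mem_inv => /andP [/andP [xr xp] xn] /andP [/andP [yr yp] yn] h.
by rewrite /posroot h actD // opprD !nonnegD.
Qed.

Lemma inv_add_or w x y : posroot x -> posroot y -> x + y \in inv w ->
  (x \in inv w) || (y \in inv w).
Proof.
move=> px py h; case: (boolP (x \in inv w)) => //= hx; apply: contraT => hy.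
rewrite !notin_inv // in hx hy; have := h; rewrite mem_inv => /andP [pxy].
rewrite actD //; have := nonnegD hx hy; rewrite -actD // => h1.
by rewrite root_nonnegN ?h1 // root_act //; exact: posroot_root.
Qed.

Lemma covers_neg w t : covers C w t <-> nonneg (- act w (a_ t)).
Proof.
rewrite /covers; split=> h.
  rewrite -actN -(@refl_simple _ _ _ C) -act_s // -actM //.
  by apply: nonneg_act_simple => //; rewrite cox_sKr ltnW.
rewrite ltnNge; apply/negP => /(@nonneg_act_simple R _ _ _ HC w t) p.
by have := root_not_neg (root_act w (root_simple t)) p; rewrite h.
Qed.

Lemma left_descent w i : (a_ i \in inv w) = (len (s_ i * w)%g < len w)%N.
Proof.
rewrite mem_inv posroot_simple /=.
have -> : (len (s_ i * w) < len w)%N = (len (w^-1 * s_ i)%g < len w^-1%g)%N.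
  by rewrite -len_inv invMg cox_sV len_inv.
by apply/idP/idP => /covers_neg.
Qed.

(** The norm 2 forces the square of the remaining coordinate to be 1. *)
Lemma root_single x i : x \in Phi -> (forall j, j != i -> x 0 j = 0) ->
  x = a_ i \/ x = - a_ i.
Proof.
move=> xr h; have xE : x = x 0 i *: a_ i.
  apply/rowP => j; rewrite mxE simple_coord.
  by have [->|ne] := eqVneq j i; rewrite ?mulr1 // mulr0 h.
have := root_norm xr; rewrite xE formZl formZr form_simpleii => e.
have : (x 0 i) ^+ 2 == 1 by apply/eqP; lra.
rewrite sqrf_eq1 => /orP [] /eqP ->; [left|right]; first by rewrite scale1r.
by rewrite scaleN1r.
Qed.

Lemma posroot_single x i : posroot x -> (forall j, j != i -> x 0 j = 0) -> x = a_ i.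
Proof.
move=> px h; case: (root_single (posroot_root px) h) => // e.
by have := posroot_ge0 i px; rewrite e mxE simple_coord eqxx oppr_ge0 ler10.
Qed.

(** Some coordinate away from [i] is positive; the reflection leaves it unchanged, and one positive
    coordinate decides the sign of a root. *)
Lemma posroot_refl i x : posroot x -> x != a_ i -> posroot (rf i x).
Proof.
move=> px ne; have xr := posroot_root px.
have [j /andP [ji xj]] : exists j, (j != i) && (x 0 j != 0).
  apply/existsP; apply: contraT; rewrite negb_exists => /forallP h.
  move: ne; rewrite (@posroot_single x i) ?eqxx // => j ji.
  by have := h j; rewrite ji negbK => /eqP.
rewrite /posroot root_refl //=; case: (root_sign (root_refl i xr)) => // /forallP /(_ j).
rewrite mxE refl_coord_neq // => h; exfalso; move/negP: xj; apply.
by rewrite eq_le (posroot_ge0 j px) andbT -oppr_ge0.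
Qed.

Lemma isint_cox i j : isint (cox_mx C R i j).
Proof.
rewrite mxE; case: ifP => _; first exact: (isint_nat _ 2).
by case: ifP => _; [apply/isintN/(isint_nat _ 1) | exact: (isint_nat _ 0)].
Qed.

Lemma isint_form x y :
  (forall i, isint (x 0 i)) -> (forall i, isint (y 0 i)) -> isint (K x y).
Proof.
move=> hx hy; rewrite form_coord; apply: isint_sum => i; apply: isintM => //.
rewrite formC form_coord; apply: isint_sum => j; apply: isintM => //.
by rewrite form_simple; exact: isint_cox.
Qed.

Lemma isint_simple i j : isint ((a_ i) 0 j).
Proof. by rewrite simple_coord; exact: isint_nat. Qed.

Lemma isint_root x i : x \in Phi -> isint (x 0 i).
Proof.
move=> /rootP [w [j ->]]; rewrite /Defs.act; elim: reduced_word i => [|k p IH] i /=.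
  exact: isint_simple.
rewrite refl_coord; apply/isintD/isintN/isintM => //; last exact: isint_nat.
by apply: isint_form => // l; exact: isint_simple.
Qed.

Lemma cover_label_pos w t : covers C w t -> posroot (- act w (a_ t)).
Proof.
by move=> /covers_neg h; rewrite /posroot rootN ?root_act ?root_simple.
Qed.

Lemma label_inv w t : covers C w t -> - act w (a_ t) \in inv w.
Proof.
move=> h; rewrite mem_inv cover_label_pos //= actN actK // opprK.
exact: nonneg_simple.
Qed.

Lemma nonneg_refl y t : y \in Phi -> y != a_ t -> y != - a_ t ->
  nonneg (rf t y) = nonneg y.
Proof.
have key z : z \in Phi -> z != a_ t -> nonneg z -> nonneg (rf t z).
  move=> zr zn zp; have pz : posroot z by rewrite /posroot zr.
  by case/andP: (posroot_refl pz zn).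
move=> yr n1 n2; apply/idP/idP => h; last exact: key.
rewrite -[y](@reflK _ _ _ C t); apply: key => //; first exact: root_refl.
by apply: contraNneq n2 => e; rewrite -[y](@reflK _ _ _ C t) e refl_simple.
Qed.

(** Since [s_ t] permutes the positive roots other than [a_ t], passing to [w * s_ t] changes the
    status of the label alone. *)
Lemma mem_inv_cover w t x : covers C w t ->
  (x \in inv (w * s_ t)%g) = (x \in inv w) && (x != - act w (a_ t)).
Proof.
move=> cv; have [->|ne] := eqVneq x (- act w (a_ t)).
  rewrite andbF; apply/negbTE; rewrite notin_inv ?cover_label_pos //.
  rewrite invMg cox_sV actM // actN actK // act_s // reflN refl_simple opprK.
  exact: nonneg_simple.
rewrite andbT; case px: (posroot x); last by rewrite !mem_inv px.
have xr := posroot_root px.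
have ar : act w^-1%g x \in Phi by apply: root_act.
rewrite !mem_inv px /= invMg cox_sV actM // act_s // -reflN nonneg_refl ?rootN //.
  apply: contraNneq ne => e; apply/eqP.
  by rewrite -e actN actVK // opprK.
rewrite eqr_opp; apply/eqP => e.
have xE : x = act w (a_ t) by rewrite -e actVK.
have /covers_neg := cv; rewrite -xE root_nonnegN //.
by case/andP: px => _ ->.
Qed.

Lemma mem_inv_refl w i x :
  posroot (rf i x) -> (rf i x \in inv w) = nonneg (- act (s_ i * w)^-1%g x).
Proof. by move=> px; rewrite mem_inv px /= invMg cox_sV actM // act_s. Qed.

Lemma mem_inv_s w i x : posroot x -> x != a_ i ->
  (rf i x \in inv w) = (x \in inv (s_ i * w)%g).
Proof.
by move=> px ne; rewrite mem_inv_refl ?posroot_refl // mem_inv px.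
Qed.

End Roots.

(** * Chambers, walls and the bound on the form *)

Section LinearForms.
Variables (R : realFieldType) (n : nat).
Implicit Types (x y z : 'rV[R]_n) (f g : 'rV[R]_n -> R).

Definition lin f : Prop := forall c x y, f (c *: x + y) = c * f x + f y.

Variables (f g : 'rV[R]_n -> R).
Hypotheses (lf : lin f) (lg : lin g).

Lemma linD x y : f (x + y) = f x + f y.
Proof. by rewrite -{1}(scale1r x) lf mul1r. Qed.

Lemma lin0 : f 0 = 0.
Proof. by have := linD 0 0; rewrite addr0 => e; lra. Qed.

Lemma linZ c x : f (c *: x) = c * f x.
Proof. by rewrite -[_ *: _]addr0 lf lin0 addr0. Qed.

Lemma linN x : f (- x) = - f x.
Proof. by rewrite -scaleN1r linZ mulN1r. Qed.

Lemma lin_coord x : f x = \sum_i x 0 i * f (simple_root R i).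
Proof.
rewrite {1}(row_simple x) (big_morph f linD lin0).
by apply: eq_bigr => i _; rewrite linZ.
Qed.

Lemma lin_comb c d : lin (fun z => c * f z + d * g z).
Proof. by move=> e x y /=; rewrite lf lg; ring. Qed.

End LinearForms.

Section Geometry.
Variables (R : realFieldType) (W : finGroupType) (n : nat).
Variables (C : coxeterSystem W n) (HC : simply_laced C).
Implicit Types (x y z : 'rV[R]_n) (i j t : 'I_n) (u v w : W).
Implicit Types (f g : 'rV[R]_n -> R).
Local Notation K := (form C).
Local Notation a_ i := (simple_root R i).
Local Notation rf i := (refl C (simple_root R i)).
Local Notation s_ := (cox_s C).
Local Notation act := (act C).
Local Notation Phi := (roots C R).
Local Notation inv := (inv C R).
Local Notation pos := (posroot C).

(* Any positive definite invariant form is proportional to [K] on the roots. *)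
Definition avg_form x y : R := \sum_(w : W) \sum_i (act w x) 0 i * (act w y) 0 i.

Lemma avg_form_act u x y : avg_form (act u x) (act u y) = avg_form x y.
Proof.
rewrite /avg_form [RHS](reindex_inj (mulIg u)) /=.
by apply: eq_bigr => w _; rewrite !actM.
Qed.

Lemma avg_formC x y : avg_form x y = avg_form y x.
Proof. by do 2!(apply: eq_bigr => ? _); rewrite mulrC. Qed.

Lemma avg_formBZ x y c z : avg_form x (y - c *: z) = avg_form x y - c * avg_form x z.
Proof.
rewrite /avg_form mulr_sumr -sumrB; apply: eq_bigr => w _.
rewrite mulr_sumr -sumrB; apply: eq_bigr => i _.
by rewrite actD // actN // actZ // !mxE; ring.
Qed.

Lemma avg_form_gt0 x : x != 0 -> 0 < avg_form x x.
Proof.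
move=> x0; rewrite /avg_form (bigD1 1%g) //= act1 //.
have [i xi] : exists i, x 0 i != 0.
  apply/existsP; apply: contraT; rewrite negb_exists => /forallP h.
  case/eqP: x0; apply/rowP => i; rewrite mxE; apply/eqP; by have := h i; rewrite negbK.
rewrite ltr_pwDl ?sumr_ge0 // => [|w _]; last by rewrite sumr_ge0 // => j _; rewrite -expr2 sqr_ge0.
rewrite (bigD1 i) //= ltr_pwDl ?sumr_ge0 // => [|j _]; last by rewrite -expr2 sqr_ge0.
by rewrite -expr2 exprn_even_gt0.
Qed.

Lemma avg_form_root x y : x \in Phi -> 2 * avg_form x y = K x y * avg_form x x.
Proof.
move=> /rootP [w [i ->]]; rewrite -{1 2}(actVK HC w y) !avg_form_act form_act //.
(* Invariance under [s_ i], which negates [a_ i], gives twice the averaged product of [a_ i] and [z]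
   as [K (a_ i) z] times the averaged norm of [a_ i]. *)
set z := act _ y; have := avg_form_act (s_ i) (a_ i) z.
rewrite !act_s // refl_simple /refl avg_formBZ.
have avN p q : avg_form (- p) q = - avg_form p q.
  have := avg_formBZ q 0 1 p; rewrite scale1r sub0r !(avg_formC q) mul1r => ->.
  by rewrite -[X in avg_form X q](subrr q) -{2}(scale1r q) avg_formC avg_formBZ mul1r subrr sub0r.
by rewrite !avN => e; lra.
Qed.

(** Positive definiteness is borrowed from [avg_form]. If [K x y] is not 0, both roots have the same
    averaged norm, and the averaged norm of [x - y] is this norm times [2 - K x y]. *)
Lemma form_root_lt2 x y : x \in Phi -> y \in Phi -> x != y -> K x y < 2.
Proof.
move=> xr yr ne; have ex := avg_form_root y xr; have ey := avg_form_root x yr.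
rewrite avg_formC formC in ey.
have [->//|k0] := eqVneq (K x y) 0.
have e : avg_form x x = avg_form y y by apply: (mulfI k0); rewrite -ex -ey.
have : 0 < avg_form (x - y) (x - y) by apply: avg_form_gt0; rewrite subr_eq0.
have -> : avg_form (x - y) (x - y) = avg_form x x - 2 * avg_form x y + avg_form y y.
  rewrite -(scale1r y) avg_formBZ !(avg_formC (x - _)) !avg_formBZ !scale1r (avg_formC y x); ring.
have := avg_form_gt0 (root_neq0 xr); rewrite ex -e => D0 h.
have {h} : 0 < (2 - K x y) * avg_form x x by lra.
by rewrite pmulr_lgt0 // subr_gt0.
Qed.

Lemma form_root_cases x y : x \in Phi -> y \in Phi -> x != y -> x != - y ->
  [\/ K x y = -1, K x y = 0 | K x y = 1].
Proof.
move=> xr yr n1 n2; apply: isint_small.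
- by apply: isint_form => i; apply: isint_root; eassumption.
- by have := form_root_lt2 xr (rootN HC yr) n2; rewrite formNr; lra.
- exact: form_root_lt2.
Qed.

Lemma lin_refl f i : lin f -> lin (fun z => f (rf i z)).
Proof. by move=> lf c x y; rewrite reflD reflZ lf. Qed.

Lemma lin_perturb (f g : 'rV[R]_n -> R) (L : seq 'rV[R]_n) :
  exists2 e, 0 < e & forall z, z \in L ->
    (f z < 0 -> f z + e * g z < 0) /\ (0 < f z -> 0 < f z + e * g z).
Proof.
(* All smaller factors are included, so that the bound may shrink at each element of the list. *)
suff [e e0 h] : exists2 e, 0 < e & forall d, 0 < d -> d <= e -> forall z, z \in L ->
    (f z < 0 -> f z + d * g z < 0) /\ (0 < f z -> 0 < f z + d * g z).
  by exists e => // z; exact: h.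
elim: L => [|y L [e e0 IH]]; first by exists 1.
have [f0|f0] := eqVneq (f y) 0.
  exists e => // d d0 de z; rewrite inE => /orP [/eqP ->|]; last exact: IH.
  by rewrite f0 ltxx.
have g1 : 0 < `|g y| + 1 by rewrite ltr_wpDl.
exists (Num.min e (`|f y| / (`|g y| + 1))).
  by rewrite lt_min e0 divr_gt0 ?normr_gt0.
move=> d d0; rewrite le_min => /andP [de]; rewrite ler_pdivlMr // => dg z.
rewrite inE => /orP [/eqP ->|]; last exact: IH.
have h : `|d * g y| < `|f y|.
  by rewrite normrM (gtr0_norm d0) (lt_le_trans _ dg) // ltr_pM2l // ltrDl.
have := ler_norm (d * g y); have := ler_norm (- (d * g y)); rewrite normrN => h1 h2.
split=> h3.
  by rewrite (ltr0_norm h3) in h; lra.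
by rewrite (gtr0_norm h3) in h; lra.
Qed.

(** The reflection embeds [L1] into [L2] and misses [a_ i], whose only preimage would be [- a_ i].
    Inductions on numbers of roots decrease by this lemma. *)
Lemma size_lt_refl i (L1 L2 : seq 'rV[R]_n) : uniq L1 -> a_ i \in L2 ->
  (forall z, z \in L1 -> z != - a_ i /\ rf i z \in L2) -> (size L1 < size L2)%N.
Proof.
move=> u1 ai h; rewrite -(size_map (rf i)).
apply: (@uniq_leq_size _ (a_ i :: map (rf i) L1) L2).
  rewrite /= map_inj_uniq ?u1 ?andbT; last exact: inv_inj (@reflK _ _ _ C i).
  apply/negP => /mapP [z zL e]; have [/eqP h1 _] := h z zL.
  by apply: h1; rewrite -[z](@reflK _ _ _ C i) -e refl_simple.
by move=> z; rewrite inE => /orP [/eqP ->//|/mapP [y yL ->]]; case: (h y yL).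
Qed.

Lemma posroot_neqN i x : pos x -> x != - a_ i.
Proof.
move=> px; apply: contraTneq px => ->; apply/negP => /andP [r p].
by have := root_not_neg r p; rewrite opprK nonneg_simple.
Qed.

(** Induction on the number of positive roots at which [f] is negative. A simple root among them is
    reflected away; if there is none, [f] is nonnegative on all positive roots and the identity
    works. *)
Lemma chamber_exists f : lin f -> (forall z, z \in Phi -> f z != 0) ->
  exists w, forall z, pos z -> (z \in inv w) = (f z < 0).
Proof.
have [k] := ubnP (size [seq z <- Phi | pos z && (f z < 0)]).
elim: k f => // k IH f; rewrite ltnS => sz lf nz.
have [[i fi]|h] : (exists i : 'I_n, f (a_ i) < 0) \/ (forall i : 'I_n, 0 <= f (a_ i)).
  have [/existsP [i fi]|] := boolP [exists i : 'I_n, f (a_ i) < 0].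
    by left; exists i.
  by rewrite negb_exists => /forallP h; right => i; rewrite leNgt.
  have [||w hw] := IH (fun z => f (rf i z)) _ (lin_refl i lf).
  - apply: leq_trans sz; apply: (@size_lt_refl i).
    + by rewrite filter_uniq // undup_uniq.
    + by rewrite mem_filter root_simple // andbT; apply/andP; split=> //; exact: posroot_simple.
    + move=> z; rewrite !mem_filter => /andP [/andP [pz fz] zr].
      rewrite posroot_neqN // fz root_refl // posroot_refl //.
      by apply: contraTneq fz => ->; rewrite refl_simple (linN lf) oppr_lt0 -leNgt ltW.
  - by move=> z zr; apply: nz; exact: root_refl.
  exists (s_ i * w)%g => z pz; have [->|ne] := eqVneq z (a_ i).
    rewrite fi mem_inv // posroot_simple // invMg cox_sV actM // act_s // refl_simple actN // opprK.
    rewrite /= -(notin_inv HC) ?posroot_simple // hw ?posroot_simple //.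
    by rewrite refl_simple (linN lf) oppr_lt0 -leNgt ltW.
  by rewrite -mem_inv_s // hw ?posroot_refl // reflK.
exists 1%g => z pz.
rewrite (negbTE (inv1 HC z)); apply/esym/negbTE; rewrite -leNgt lin_coord //.
by apply: sumr_ge0 => i _; rewrite mulr_ge0 ?h // (posroot_ge0 i pz).
Qed.

(** A point inside the facet of type [t] of the chamber of [u]: the sum of the fundamental coweights
    other than the one of [t], moved by [u]. *)
Definition wall u t z : R := \sum_(i | i != t) (act u^-1%g z) 0 i.

Lemma lin_wall u t : lin (wall u t).
Proof.
move=> c x y; rewrite /wall mulr_sumr -big_split; apply: eq_bigr => i _.
by rewrite actD // actZ // !mxE.
Qed.

Lemma wall_label u t : wall u t (act u (a_ t)) = 0.
Proof.
rewrite /wall actK //; apply: big1 => i it.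
by rewrite simple_coord (negbTE it).
Qed.

Lemma wall_gt0 u t z : z \in Phi -> z != act u (a_ t) -> nonneg (act u^-1%g z) ->
  0 < wall u t z.
Proof.
move=> zr ne p; have pz : pos (act u^-1%g z) by rewrite /posroot root_act.
rewrite lt_neqAle eq_sym sumr_ge0 ?andbT => [|i _]; last exact: (posroot_ge0 i pz).
apply: contra ne; rewrite psumr_eq0 => [|i _]; last exact: (posroot_ge0 i pz).
move=> /allP h; apply/eqP; rewrite -(posroot_single pz) ?actVK //.
by move=> j jt; apply/eqP; have := h j (mem_index_enum j); rewrite jt.
Qed.

Lemma wall_eq0 u t z : z \in Phi -> z != act u (a_ t) -> z != - act u (a_ t) ->
  wall u t z != 0.
Proof.
move=> zr n1 n2; have [p|p] := root_sign HC (root_act HC u^-1%g zr).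
  by rewrite gt_eqF // wall_gt0.
rewrite -oppr_eq0 -(linN (lin_wall u t)) gt_eqF // wall_gt0 ?rootN //.
  by rewrite eqr_oppLR.
by rewrite actN.
Qed.

Lemma wall_inv w t z : covers C w t -> z \in inv w -> z != - act w (a_ t) ->
  wall w t z < 0.
Proof.
move=> cv zi ne; rewrite -oppr_gt0 -(linN (lin_wall w t)); move: zi.
rewrite mem_inv // => /andP [/posroot_root zr h].
by rewrite wall_gt0 ?rootN // ?actN // eqr_oppLR.
Qed.

Lemma wall_notin w t z : covers C w t -> pos z -> z \notin inv w -> 0 < wall w t z.
Proof.
move=> cv pz; rewrite notin_inv // => h; rewrite wall_gt0 // ?posroot_root //.
have /(covers_neg R HC) := cv; apply: contraTneq => <-.
by case/andP: pz => zr zp; exact: (root_not_neg zr zp).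
Qed.

(* The point [f1] of the hyperplane orthogonal to [b] is moved towards [f2],
   then to a generic point of that hyperplane, and finally off it. *)
Lemma cover_exists b f1 f2 : pos b -> lin f1 -> lin f2 -> f1 b = 0 -> f2 b = 0 ->
  exists w t, [/\ covers C w t, b = - act w (a_ t) &
    forall z, pos z -> z != b ->
    [/\ f1 z < 0 -> z \in inv w, f1 z = 0 -> f2 z < 0 -> z \in inv w &
        0 < f1 z -> z \notin inv w]].
Proof.
move=> pb l1 l2 b1 b2; have /rootP [u [i bE]] := posroot_root pb.
have [e1 e10 h1] := lin_perturb f1 f2 Phi.
set F2 := fun z => f1 z + e1 * f2 z.
have [e2 e20 h2] := lin_perturb F2 (wall u i) Phi.
set F3 := fun z => F2 z + e2 * wall u i z.
(* Minus the height is negative on [b], so the last move makes [b] an inversion. *)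
pose ht := fun z : 'rV[R]_n => - \sum_j z 0 j.
have lht : lin ht.
  move=> c x y; rewrite /ht mulrN mulr_sumr -opprD -big_split; congr (- _).
  by apply: eq_bigr => j _; rewrite !mxE.
have [e3 e30 h3] := lin_perturb F3 ht Phi.
set F4 := fun z => F3 z + e3 * ht z.
have lF2 : lin F2 by move=> c x y; rewrite /F2 l1 l2; ring.
have lF3 : lin F3 by move=> c x y; rewrite /F3 lF2 lin_wall; ring.
have lF4 : lin F4 by move=> c x y; rewrite /F4 lF3 lht; ring.
have F3b : F3 b = 0 by rewrite /F3 /F2 b1 b2 bE wall_label !mulr0 !addr0.
have F3n z : z \in Phi -> z != b -> z != - b -> F3 z != 0.
  move=> zr n1 n2; have [p1 p2] := h2 z zr.
  have [q|q|q] := ltrgt0P (F2 z).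
  - by rewrite gt_eqF // p2.
  - by rewrite lt_eqF // p1.
  - by rewrite /F3 q add0r; apply: mulf_neq0; [rewrite gt_eqF | rewrite wall_eq0 -?bE].
have F4b : F4 b < 0.
  rewrite /F4 F3b add0r pmulr_rlt0 // oppr_lt0 lt_neqAle eq_sym.
  rewrite sumr_ge0 ?andbT => [|j _]; last exact: (posroot_ge0 j pb).
  have := root_neq0 (posroot_root pb); apply: contra.
  rewrite psumr_eq0 => [/allP h|j _]; last exact: (posroot_ge0 j pb).
  by apply/eqP/rowP => j; rewrite [RHS]mxE; apply/eqP; exact: (h j (mem_index_enum j)).
have F34 z : z \in Phi -> z != b -> z != - b -> (F4 z < 0) = (F3 z < 0).
  move=> zr n1 n2; have [p1 p2] := h3 z zr; have := F3n z zr n1 n2.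
  case: (ltrgt0P (F3 z)) => // q _; last by rewrite p1.
  by apply/negbTE; rewrite -leNgt ltW // p2.
have F4n z : z \in Phi -> F4 z != 0.
  move=> zr; have [->|n1] := eqVneq z b; first by rewrite lt_eqF.
  have [->|n2] := eqVneq z (- b); first by rewrite (linN lF4) oppr_eq0 lt_eqF.
  have [p1 p2] := h3 z zr; have := F3n z zr n1 n2.
  by case: (ltrgt0P (F3 z)) => // q _; [rewrite gt_eqF // p2 | rewrite lt_eqF // p1].
have [w hw] := chamber_exists lF4 F4n.
have bw : b \in inv w by rewrite hw.
set c := - act w^-1%g b.
have pc : pos c.
  rewrite /posroot; have := bw; rewrite mem_inv // => /andP [_ ->].
  by rewrite rootN // root_act // posroot_root.
have F4w j : 0 < F4 (act w (a_ j)).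
  have ar : act w (a_ j) \in Phi by rewrite root_act // root_simple.
  rewrite lt_neqAle eq_sym F4n //=; case: (root_sign HC ar) => p.
    rewrite leNgt -hw /posroot ?ar // mem_inv // actK //.
    by rewrite (negbTE (root_not_neg (root_simple R HC j) (nonneg_simple R j))) andbF.
  rewrite -oppr_le0 -(linN lF4) ltW // -hw /posroot ?rootN // mem_inv // actN actK //.
  by rewrite opprK nonneg_simple andbT /posroot rootN.
have [[t ct]|h] : (exists t : 'I_n, c = a_ t) \/ (forall t : 'I_n, c != a_ t).
  have [/existsP [i0 /eqP fi]|] := boolP [exists i0 : 'I_n, c == a_ i0].
    by left; exists i0.
  by rewrite negb_exists => /forallP h; right.
  have bt : b = - act w (a_ t) by rewrite -ct /c actN actVK // opprK.
  exists w, t; split=> //.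
    by apply/(covers_neg R HC); rewrite -bt; case/andP: pb.
  move=> z pz zb; have zr := posroot_root pz.
  have nz : z != - b.
    apply: contraTneq pz => ->; rewrite /posroot negb_and.
    by case/andP: pb => br bp; rewrite (root_not_neg br bp) orbT.
  have [p1 p2] := h1 z zr; have [q1 q2] := h2 z zr.
  rewrite hw // F34 //; split=> [hz|hz1 hz2|hz].
  - exact/q1/p1.
  - by apply: q1; rewrite /F2 hz1 add0r pmulr_rlt0.
  - by rewrite -leNgt ltW //; apply/q2/p2.
(* If [c] were not simple, [F3] would be positive on every [act w (a_ j)], hence on [act w c], where
   it vanishes. *)
exfalso.
have F3w j : 0 < F3 (act w (a_ j)).
  have ar : act w (a_ j) \in Phi by rewrite root_act // root_simple.
  have n1 : act w (a_ j) != b.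
    apply/eqP => e; have := posroot_neqN j pc.
    by rewrite /c -e actK // eqxx.
  have n2 : act w (a_ j) != - b.
    by apply/eqP => e; have := h j; rewrite /c -actN -e actK // eqxx.
  rewrite lt_neqAle eq_sym F3n //= leNgt -F34 // -leNgt ltW //.
have : F3 (act w c) = 0 by rewrite /c actN actVK // (linN lF3) F3b oppr0.
have lw : lin (fun z => F3 (act w z)) by move=> d x y; rewrite actD // actZ // lF3.
rewrite (lin_coord lw) => /eqP; rewrite psumr_eq0 => [/allP hc|j _].
  have := root_neq0 (posroot_root pc); case/eqP; apply/rowP => j.
  rewrite [RHS]mxE; apply/eqP; have := hc j (mem_index_enum j); rewrite mulf_eq0.
  by rewrite (gt_eqF (F3w j)) orbF.
by rewrite mulr_ge0 ?(posroot_ge0 j pc) // ltW.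
Qed.

End Geometry.

(** * The Euler form *)

Section Euler.
Variables (R : realFieldType) (W : finGroupType) (n : nat).
Variables (C : coxeterSystem W n) (HC : simply_laced C).
Implicit Types (x y z : 'rV[R]_n) (i j s t : 'I_n) (q : seq 'I_n) (u v w : W).
Local Notation K := (form C).
Local Notation a_ i := (simple_root R i).
Local Notation rf i := (refl C (simple_root R i)).
Local Notation s_ := (cox_s C).
Local Notation act := (act C).
Local Notation Phi := (roots C R).
Local Notation inv := (inv C R).
Local Notation pos := (posroot C).
Local Notation cm := (cox_mx C R).

(* The Euler form of the Coxeter element of the standard parabolic subgroup
   with reduced word [q]; coordinates outside [q] are ignored. *)
Fixpoint eul q x y : R :=
  if q is s :: q' then
    y 0 s * (x 0 s + \sum_(i <- q') x 0 i * cm i s) + eul q' x y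
  else 0.

Definition om q x y : R := eul q x y - eul q y x.

Definition supp q x : Prop := forall i, i \notin q -> x 0 i = 0.

Lemma eul_linl q y : lin (fun x => eul q x y).
Proof.
move=> c x1 x2; elim: q => [|s q IH] /=; first by rewrite mulr0 addr0.
rewrite IH (eq_bigr (fun i => c * (x1 0 i * cm i s) + x2 0 i * cm i s)).
  by rewrite big_split -mulr_sumr !mxE /=; ring.
by move=> i _; rewrite !mxE; ring.
Qed.

Lemma eul_linr q x : lin (eul q x).
Proof.
by move=> c y1 y2; elim: q => [|s q IH] /=; rewrite ?IH ?mxE; ring.
Qed.

Lemma om_linr q x : lin (om q x).
Proof. by move=> c y1 y2; rewrite /om eul_linr eul_linl; ring. Qed.

Lemma om_anti q x y : om q x y = - om q y x.
Proof. by rewrite /om opprB. Qed.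

Lemma om_same q x : om q x x = 0.
Proof. by rewrite /om subrr. Qed.

Lemma eul_rcons q s x y : eul (rcons q s) x y =
  x 0 s * (y 0 s + \sum_(j <- q) cm s j * y 0 j) + eul q x y.
Proof.
elim: q => [|r q IH] /=; first by rewrite !big_nil; ring.
by rewrite IH big_rcons big_cons /=; ring.
Qed.

Lemma eul_eq q x x' y y' : (forall i, i \in q -> x 0 i = x' 0 i) ->
  (forall i, i \in q -> y 0 i = y' 0 i) -> eul q x y = eul q x' y'.
Proof.
elim: q => //= s q IH hx hy; rewrite hx ?hy ?mem_head //.
rewrite IH => [|i iq|i iq]; rewrite ?hx ?hy ?inE ?iq ?orbT //.
congr (_ * (_ + _) + _); apply: eq_big_seq => i iq.
by rewrite hx // inE iq orbT.
Qed.

Lemma eul0l q x y : (forall i, i \in q -> x 0 i = 0) -> eul q x y = 0.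
Proof.
move=> h; rewrite (@eul_eq q x 0 y y) // => [|i iq]; last by rewrite h // mxE.
exact: lin0 (eul_linl q y).
Qed.

Lemma eul0r q x y : (forall i, i \in q -> y 0 i = 0) -> eul q x y = 0.
Proof.
move=> h; rewrite (@eul_eq q x x y 0) // => [|i iq]; last by rewrite h // mxE.
exact: lin0 (eul_linr q x).
Qed.

Lemma form_supp s q x : uniq (s :: q) -> supp (s :: q) x ->
  K x (a_ s) = 2 * x 0 s + \sum_(i <- q) x 0 i * cm i s.
Proof.
move=> uq sx; rewrite formC form_coord.
rewrite (bigID (mem (s :: q))) /= [X in _ + X]big1 => [|i ni]; last by rewrite sx ?mul0r.
rewrite addr0 -big_uniq // big_cons form_simpleii mulrC.
by congr (_ + _); apply: eq_bigr => i _; rewrite formC form_simple.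
Qed.

Lemma refl_coord_supp s q x : uniq (s :: q) -> supp (s :: q) x ->
  (rf s x) 0 s = - (x 0 s + \sum_(i <- q) x 0 i * cm i s).
Proof. by move=> uq sx; rewrite refl_coord_eq (form_supp uq sx); ring. Qed.

Lemma refl_coord_in s q x i : uniq (s :: q) -> i \in q -> (rf s x) 0 i = x 0 i.
Proof.
by move=> /andP [sq _] iq; apply: refl_coord_neq; apply: contraNneq sq => <-.
Qed.

(** Only the terms involving [s] change. The [s]-coordinate of [rf s x] is minus the factor of
    [y 0 s] in the first term of [eul (s :: q) x y], and the other factor in the last term of the
    rotated form is [- y 0 s]. *)
Lemma eul_rot s q x y : uniq (s :: q) -> supp (s :: q) x -> supp (s :: q) y ->
  eul (rcons q s) (rf s x) (rf s y) = eul (s :: q) x y.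
Proof.
move=> uq sx sy; rewrite eul_rcons /= (refl_coord_supp uq sx) (refl_coord_supp uq sy).
rewrite (@eul_eq q (rf s x) x (rf s y) y); try by move=> i; exact: refl_coord_in.
have -> : \sum_(j <- q) cm s j * (rf s y) 0 j = \sum_(i <- q) y 0 i * cm i s.
  by apply: eq_big_seq => i iq; rewrite (refl_coord_in _ uq) // cox_mxC mulrC.
ring.
Qed.

Lemma simple_coord1 s : (a_ s) 0 s = 1.
Proof. by rewrite simple_coord eqxx. Qed.

Lemma simple_coord_notin s q i : s \notin q -> i \in q -> (a_ s) 0 i = 0.
Proof.
by move=> sq iq; rewrite simple_coord; case: eqP => // e; rewrite -e iq in sq.
Qed.

Lemma eul_simple_l s q y : s \notin q -> eul (s :: q) (a_ s) y = y 0 s.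
Proof.
move=> sq /=; rewrite eul0l => [|i]; last exact: simple_coord_notin.
rewrite big1_seq => [|i /andP [_ iq]]; last by rewrite (simple_coord_notin sq) // mul0r.
by rewrite simple_coord1; ring.
Qed.

Lemma eul_simple_r s q x : uniq (s :: q) -> supp (s :: q) x ->
  eul (s :: q) x (a_ s) = - (rf s x) 0 s.
Proof.
move=> uq sx; rewrite (refl_coord_supp uq sx) opprK /= eul0r => [|i].
  by rewrite simple_coord1; ring.
by case/andP: uq => sq _; exact: simple_coord_notin.
Qed.

Lemma eul_rcons_r s q x : s \notin q -> eul (rcons q s) x (a_ s) = x 0 s.
Proof.
move=> sq; rewrite eul_rcons eul0r => [|i]; last exact: simple_coord_notin.
rewrite big1_seq => [|i /andP [_ iq]]; last by rewrite (simple_coord_notin sq) // mulr0.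
by rewrite simple_coord1; ring.
Qed.

Lemma eul_rcons_l s q y : uniq (s :: q) -> supp (s :: q) y ->
  eul (rcons q s) (a_ s) y = - (rf s y) 0 s.
Proof.
move=> uq sy; rewrite (refl_coord_supp uq sy) opprK eul_rcons eul0l => [|i].
  rewrite (eq_bigr (fun i => y 0 i * cm i s)) => [|i _]; last by rewrite cox_mxC mulrC.
  by rewrite simple_coord1; ring.
by case/andP: uq => sq _; exact: simple_coord_notin.
Qed.

Lemma eul_cons0 s q x y : y 0 s = 0 -> eul (s :: q) x y = eul q x y.
Proof. by move=> /= ->; rewrite mul0r add0r. Qed.

Lemma supp_refl s q x : s \in q -> supp q x -> supp q (rf s x).
Proof.
move=> sq sx i iq; rewrite refl_coord_neq ?sx //.
by apply: contraNneq iq => ->.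
Qed.

Lemma supp_simple s q : s \in q -> supp q (a_ s).
Proof. by move=> sq i iq; apply: (@simple_coord_notin s [:: i]); rewrite ?inE //; apply: contraNneq iq => <-. Qed.

Lemma supp_rcons s q x : supp (rcons q s) x <-> supp (s :: q) x.
Proof. by split=> h i iq; apply: h; move: iq; rewrite mem_rcons. Qed.

Lemma supp_cons s q x : supp q x -> supp (s :: q) x.
Proof. by move=> h i; rewrite inE negb_or => /andP [_]; exact: h. Qed.

Lemma supp_cons0 s q x : supp (s :: q) x -> x 0 s = 0 -> supp q x.
Proof.
move=> h x0 i iq; have [->//|ne] := eqVneq i s.
by apply: h; rewrite inE negb_or ne.
Qed.

Lemma supp_addl q x y : pos x -> pos y -> supp q (x + y) -> supp q x.
Proof.
move=> px py h i iq; have := h i iq; rewrite mxE => e.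
by have := posroot_ge0 i px; have := posroot_ge0 i py; lra.
Qed.

Lemma supp_addr q x y : pos x -> pos y -> supp q (x + y) -> supp q y.
Proof. by move=> px py; rewrite addrC; exact: supp_addl. Qed.

Lemma eul_sym q x y : uniq q -> supp q x -> supp q y ->
  eul q x y + eul q y x = K x y.
Proof.
elim: q x y => [|s q IH] x y uq sx sy.
  by rewrite addr0 form_coord big1 // => i _; rewrite sy // mul0r.
(* Removing the [s]-component brings the vectors into the support [q] without changing the
   coordinates that [eul q] reads. *)
have split z : supp (s :: q) z -> supp q (z - z 0 s *: a_ s).
  move=> sz; apply: (@supp_cons0 s); last by rewrite 3!mxE simple_coord1 mulr1 subrr.
  move=> i ni; rewrite 3!mxE (sz i ni) simple_coord.
  by case: eqP ni => [->|_ _]; rewrite ?mem_head // mulr0 subr0.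
have e0 z i : i \in q -> (z - z 0 s *: a_ s) 0 i = z 0 i.
  move=> iq; case/andP: uq => sq _.
  by rewrite 3!mxE (simple_coord_notin sq iq) mulr0 subr0.
have /andP [_ uq'] := uq; have := IH _ _ uq' (split x sx) (split y sy).
have r z z' : eul q (z - z 0 s *: a_ s) (z' - z' 0 s *: a_ s) = eul q z z'.
  by apply: eul_eq => i; exact: e0.
rewrite !r.
have -> : K (x - x 0 s *: a_ s) (y - y 0 s *: a_ s) =
    K x y - y 0 s * K x (a_ s) - x 0 s * K y (a_ s) + 2 * x 0 s * y 0 s.
  rewrite formDl formNl formZl !formBZr form_simpleii (formC C (a_ s) y); ring.
rewrite (form_supp uq sx) (form_supp uq sy) /=.
set A := \sum_(i <- q) x 0 i * _; set B := \sum_(i <- q) y 0 i * _ => e.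
have -> : K x y = eul q x y + eul q y x
    + y 0 s * (2 * x 0 s + A) + x 0 s * (2 * y 0 s + B) - 2 * x 0 s * y 0 s.
  by rewrite e; ring.
ring.
Qed.

Lemma isint_eul q x y : (forall i, isint (x 0 i)) -> (forall i, isint (y 0 i)) ->
  isint (eul q x y).
Proof.
move=> hx hy; elim: q => [|s q IH] /=; first exact: (isint_nat _ 0).
apply/isintD => //; apply/isintM/isintD/isint_sum => // i.
by apply/isintM/isint_cox.
Qed.

Lemma form_sum_root x y : x \in Phi -> y \in Phi -> x + y \in Phi -> K x y = -1.
Proof.
move=> /root_norm hx /root_norm hy /root_norm.
by rewrite formDl !formDr hx hy (formC C y x) => h; lra.
Qed.

(* [eul x y + eul y x = K x y = -1] is odd *)
Lemma om_neq0 q x y : uniq q -> x \in Phi -> y \in Phi -> x + y \in Phi ->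
  supp q x -> supp q y -> om q x y != 0.
Proof.
move=> uq xr yr xyr sx sy; have e := eul_sym uq sx sy.
rewrite form_sum_root // in e; apply/eqP => h.
have [z ze] : isint (eul q x y) by apply: isint_eul => i; apply: isint_root; eassumption.
have : (2 * z + 1)%:~R = 0 :> R.
  by rewrite rmorphD rmorphM /= -ze; rewrite /om in h; lra.
by move=> /eqP; rewrite intr_eq0 => /eqP; lia.
Qed.

Lemma om_rot s q x y : uniq (s :: q) -> supp (s :: q) x -> supp (s :: q) y ->
  om (rcons q s) (rf s x) (rf s y) = om (s :: q) x y.
Proof. by move=> uq sx sy; rewrite /om !eul_rot. Qed.

Lemma om_rot' s q x y : uniq (s :: q) -> supp (s :: q) x -> supp (s :: q) y ->
  om (rcons q s) x y = om (s :: q) (rf s x) (rf s y).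
Proof.
move=> uq sx sy; rewrite -om_rot ?reflK //; exact: supp_refl (mem_head _ _) _.
Qed.

(** The value is minus the sum of the [s]-coordinates of [x] and [rf s x], both positive roots. So
    the initial simple root comes first in the order given by [om]; by the next lemma the final one
    comes last. *)
Lemma om_simple_le0 s q x : uniq (s :: q) -> supp (s :: q) x -> pos x -> x != a_ s ->
  om (s :: q) x (a_ s) <= 0.
Proof.
move=> uq sx px ne; rewrite /om eul_simple_r // eul_simple_l; last by case/andP: uq.
have := posroot_ge0 s px; have := posroot_ge0 s (posroot_refl HC px ne); lra.
Qed.

Lemma om_rcons_le0 s q y : uniq (s :: q) -> supp (s :: q) y -> pos y -> y != a_ s ->
  om (rcons q s) (a_ s) y <= 0.
Proof.
move=> uq sy py ne; rewrite /om eul_rcons_l // eul_rcons_r; last by case/andP: uq.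
have := posroot_ge0 s py; have := posroot_ge0 s (posroot_refl HC py ne); lra.
Qed.

End Euler.

(** * Projection to sortable elements *)

Section Projection.
Variables (R : realFieldType) (W : finGroupType) (n : nat).
Variables (C : coxeterSystem W n) (HC : simply_laced C).
Implicit Types (x y z : 'rV[R]_n) (i j s t : 'I_n) (q : seq 'I_n) (u v w : W).
Local Notation K := (form C).
Local Notation a_ i := (simple_root R i).
Local Notation rf i := (refl C (simple_root R i)).
Local Notation s_ := (cox_s C).
Local Notation len := (cox_length C).
Local Notation act := (act C).
Local Notation Phi := (roots C R).
Local Notation inv := (inv C R).
Local Notation pos := (posroot C).
Local Notation eul := (eul C).
Local Notation om := (om C).

(* [v] is the largest element below [w] that is sortable for the Coxeter element
   [q] of the standard parabolic subgroup generated by [q]. *)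
Inductive proj : seq 'I_n -> W -> W -> Prop :=
| proj_nil w : proj [::] w 1%g
| proj_take s q w v : a_ s \in inv w -> proj (rcons q s) (s_ s * w)%g v ->
    proj (s :: q) w (s_ s * v)%g
| proj_skip s q w v : a_ s \notin inv w -> proj q w v -> proj (s :: q) w v.

Lemma uniq_rot1 s q : uniq (rcons q s) = uniq (s :: q).
Proof. by rewrite rcons_uniq. Qed.

Lemma simple_notin_inv_s s w : a_ s \in inv w -> a_ s \notin inv (s_ s * w)%g.
Proof. by rewrite !left_descent // cox_sK -leqNgt => /ltnW. Qed.

Lemma simple_in_inv_s s w : a_ s \notin inv w -> a_ s \in inv (s_ s * w)%g.
Proof.
rewrite notin_inv ?posroot_simple // => h.
rewrite mem_inv // posroot_simple //= invMg cox_sV actM // act_s // refl_simple.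
by rewrite actN // opprK.
Qed.

Lemma refl_neq_simple s x : pos x -> rf s x != a_ s.
Proof.
move=> px; apply: contraTneq px => e.
rewrite -[x](@reflK _ _ _ C s) e refl_simple.
by apply/negP => /(posroot_neqN s); rewrite eqxx.
Qed.

Lemma mem_inv_take s v x : pos x ->
  x != a_ s -> (x \in inv (s_ s * v)%g) = (rf s x \in inv v).
Proof. by move=> px ne; rewrite mem_inv_s. Qed.

Lemma mem_inv_takeV s v x : pos x ->
  x != a_ s -> (rf s x \in inv (s_ s * v)%g) = (x \in inv v).
Proof.
by move=> px ne; rewrite -mem_inv_s ?reflK ?posroot_refl ?refl_neq_simple.
Qed.

Lemma proj_sub q w v : proj q w v -> {subset inv v <= inv w}.
Proof.
elim=> {q w v} [w|s q w v sw pr IH|s q w v _ _ //] x.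
  by rewrite (negbTE (inv1 HC x)).
have [->//|ne] := eqVneq x (a_ s).
move=> xi; have px := inv_posroot HC xi; move: xi.
by rewrite mem_inv_take // => /IH; rewrite -mem_inv_take ?cox_sK.
Qed.

Lemma proj_supp q w v x : proj q w v -> x \in inv v -> supp q x.
Proof.
move=> pr; elim: pr x => {q w v} [w|s q w v sw pr IH|s q w v _ _ IH] x.
- by rewrite (negbTE (inv1 HC x)).
- have [-> _|ne xi] := eqVneq x (a_ s); first by apply: supp_simple; rewrite mem_head.
  have px := inv_posroot HC xi; rewrite mem_inv_take // in xi.
  move/IH/supp_rcons: xi => /(@supp_refl _ _ _ C s _ _ (mem_head _ _)).
  by rewrite reflK.
- by move/IH/supp_cons.
Qed.

Lemma proj_exists q w : exists v, proj q w v.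
Proof.
have [k] := ubnP (len w + size q); elim: k q w => // k IH [|s q] w; rewrite ltnS => h.
  by exists 1%g; constructor.
have [d|d] := boolP (a_ s \in inv w).
  have [|v pv] := IH (rcons q s) (s_ s * w)%g.
    rewrite left_descent // in d; rewrite size_rcons.
    by apply: leq_trans h; rewrite ltn_add2r.
  by exists (s_ s * v)%g; constructor.
have [|v pv] := IH q w; first by apply: leq_trans h; rewrite addnS.
by exists v; constructor.
Qed.

Lemma proj_take_inv s q w v : proj (s :: q) w v -> a_ s \in inv w ->
  exists2 v', v = (s_ s * v')%g & proj (rcons q s) (s_ s * w)%g v'.
Proof.
move=> pr d; inversion pr as [|s' q' w' v' h1 h2 e1 e2 e3|s' q' w' v' h1 h2]; subst.
  by exists v'.
by rewrite d in h1.
Qed.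

Lemma proj_skip_inv s q w v : proj (s :: q) w v -> a_ s \notin inv w -> proj q w v.
Proof.
move=> pr d; inversion pr as [|s' q' w' v' h1 h2 e1 e2 e3|s' q' w' v' h1 h2]; subst=> //.
by rewrite h1 in d.
Qed.

Lemma proj_nil_inv w v : proj [::] w v -> v = 1%g.
Proof. by move=> pr; inversion pr. Qed.

Lemma proj_idem q w v : proj q w v -> proj q v v.
Proof.
elim=> {q w v} [w|s q w v d pr IH|s q w v d pr IH].
- exact: proj_nil.
- apply: proj_take; last by rewrite cox_sK.
  apply: simple_in_inv_s; apply: contra (simple_notin_inv_s d).
  exact: (proj_sub pr).
- by apply: proj_skip => //; apply: contra d; exact: (proj_sub pr).
Qed.

Lemma simple_notin_proj s q w v : a_ s \in inv w -> proj q (s_ s * w)%g v ->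
  a_ s \notin inv v.
Proof. by move=> d pr; apply: contra (simple_notin_inv_s d); exact: (proj_sub pr). Qed.

(** Detects non-inversions of [w] from the inversions of its projection. If [s] is taken, the
    [s]-coordinate of [rf s k] is [- eul (s :: q) k (a_ s)], hence nonnegative, and the recursion
    applies to [rf s k]. If [s] is skipped, [w^-1] keeps [a_ s] positive, so the [s]-component of
    [k] may be split off. *)
Lemma proj_dual_cone q w v : proj q w v -> uniq q -> forall k : 'rV[R]_n,
  nonneg k -> supp q k -> (forall x, x \in inv v -> eul q k x <= 0) ->
  nonneg (act w^-1%g k).
Proof.
elim=> {q w v} [w|s q w v d pr IH|s q w v d pr IH] uq k pk sk hk.
- have -> : k = 0 by apply/rowP => i; rewrite mxE sk.
  by rewrite act0; apply/forallP => i; rewrite mxE.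
- have vs := simple_notin_proj d pr.
  rewrite -[k](@reflK _ _ _ C s) -act_s // -actM // -{1}(cox_sV C s) -invMg.
  apply: IH; rewrite ?uniq_rot1 //.
  + apply/forallP => i; have [->|ne] := eqVneq i s; last by rewrite refl_coord_neq // (forallP pk).
    by rewrite -oppr_le0 -(eul_simple_r C uq sk) hk // simple_in_inv_s.
  + by apply/supp_rcons/supp_refl => //; rewrite mem_head.
  + move=> x xv; have px := inv_posroot HC xv.
    have ne : x != a_ s by apply: contraNneq vs => <-.
    have sx : supp (s :: q) x by apply/supp_rcons; exact: proj_supp pr xv.
    rewrite -[x](@reflK _ _ _ C s) eul_rot //; last by apply: supp_refl; rewrite ?mem_head.
    by rewrite hk // mem_inv_takeV.
- set k0 := k - k 0 s *: a_ s.
  have kE : k = k0 + k 0 s *: a_ s by rewrite /k0 subrK.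
  rewrite kE actD // actZ // nonnegD //; last first.
    by rewrite nonnegZ ?(forallP pk) // -notin_inv ?posroot_simple.
  have /andP [sq uq'] := uq.
  have k0q i : i != s -> k0 0 i = k 0 i.
    by move=> /negbTE ne; rewrite 3!mxE simple_coord ne mulr0 subr0.
  have k0s : k0 0 s = 0 by rewrite 3!mxE simple_coord1 mulr1 subrr.
  apply: IH => //.
  + apply/forallP => i; have [->|/k0q ->] := eqVneq i s; first by rewrite k0s.
    exact: (forallP pk).
  + move=> i iq; have [->//|ne] := eqVneq i s.
    by rewrite k0q // sk // inE negb_or ne.
  + move=> x xv; have := hk x xv; have sx := proj_supp pr xv.
    rewrite eul_cons0 ?sx // => h; rewrite (@eul_eq _ _ _ C q _ k _ x) // => i iq.
    by rewrite k0q //; apply: contraNneq sq => <-.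
Qed.

(** When [s] is taken the decomposition is reflected. The exceptions are harmless: [x = a_ s] is an
    inversion, and [y = a_ s] contradicts the sign of [om]. *)
Lemma proj_aligned q w v : proj q w v -> uniq q -> forall x y,
  pos x -> pos y -> x + y \in inv v -> 0 < om q x y -> x \in inv v.
Proof.
elim=> {q w v} [w|s q w v d pr IH|s q w v d pr IH] uq x y px py.
- by rewrite (negbTE (inv1 HC (x + y))).
- move=> xyv; have sxy : supp (s :: q) (x + y).
    by apply: (@proj_supp (s :: q) w (s_ s * v)%g) => //; apply: proj_take.
  have sx := supp_addl px py sxy; have sy := supp_addr px py sxy.
  have vs := simple_notin_proj d pr.
  have [->|nx] := eqVneq x (a_ s); first by rewrite simple_in_inv_s.
  have [->|ny] := eqVneq y (a_ s).
    by rewrite ltNge (om_simple_le0 HC).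
  (* Otherwise the positive roots [rf s x] and [rf s y] would add up to [- a_ s]. *)
  have nxy : x + y != a_ s.
    apply/eqP => e; have := posroot_refl HC px nx; have := posroot_refl HC py ny.
    move=> /(posroot_ge0 s) h1 /(posroot_ge0 s) h2.
    by have := congr1 (fun z => (rf s z) 0 s) e; rewrite reflD refl_simple mxE [RHS]mxE simple_coord1; lra.
  rewrite -(om_rot C uq sx sy) => o.
  rewrite mem_inv_take //; apply: (IH _ _ (rf s y)) => //; rewrite ?uniq_rot1 ?posroot_refl //.
  by rewrite -reflD -mem_inv_take // (inv_posroot HC xyv).
- move=> xyv o; have sxy := proj_supp pr xyv.
  have sx := supp_addl px py sxy; have sy := supp_addr px py sxy.
  have /andP [sq uq'] := uq.
  by apply: (IH uq' x y) => //; move: o; rewrite /om !eul_cons0 ?sx ?sy.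
Qed.

Lemma label_refl w t s : - act (s_ s * w)%g (a_ t) = rf s (- act w (a_ t)).
Proof. by rewrite actM // act_s // reflN. Qed.

Lemma covers_refl w t s : covers C w t -> - act w (a_ t) != a_ s ->
  covers C (s_ s * w)%g t.
Proof.
move=> cv ne; apply/(covers_neg R HC); rewrite label_refl.
by case/andP: (posroot_refl HC (cover_label_pos R HC cv) ne).
Qed.

(** The recursions for [w] and [w * s_ t] could only part where the reflected label is the initial
    simple root and is taken, but then the label would be an inversion of [v]. *)
Lemma proj_contract q w v : proj q w v -> forall t v', covers C w t ->
  proj q (w * s_ t)%g v' -> - act w (a_ t) \notin inv v -> v' = v.
Proof.
elim=> {q w v} [w|s q w v d pr IH|s q w v d pr IH] t v' cv.
- by move/proj_nil_inv.
- have [->|ne] := eqVneq (- act w (a_ t)) (a_ s).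
    by rewrite simple_in_inv_s ?(simple_notin_proj d pr).
  move=> pr' nl; have d' : a_ s \in inv (w * s_ t)%g by rewrite mem_inv_cover // d eq_sym.
  have [v2 ->] := proj_take_inv pr' d'; rewrite mulgA => pr2.
  congr (_ * _)%g; apply: (IH t) => //; first exact: covers_refl.
  by rewrite label_refl -mem_inv_take ?cover_label_pos.
- move=> pr'; apply: IH => //; apply: proj_skip_inv pr' _.
  by rewrite mem_inv_cover // (negbTE d).
Qed.

(** Both recursions run in parallel until the reflected label is the initial simple root [a_ s].
    There [w * s_ t] discards [s], so all later inversions have [s]-coordinate 0, which is their
    Euler product with [a_ s]. Before that, an inversion equal to the initial simple root is treated
    by [eul_simple_r]. *)
Lemma proj_label_orth q w v : proj q w v -> uniq q -> forall t v', covers C w t ->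
  proj q (w * s_ t)%g v' -> - act w (a_ t) \in inv v ->
  forall x, x \in inv v' -> eul q (- act w (a_ t)) x <= 0.
Proof.
elim=> {q w v} [w|s q w v d pr IH|s q w v d pr IH] uq t v' cv pr'.
- by rewrite (negbTE (inv1 HC (- act w (a_ t)))).
- have [lE|ne] := eqVneq (- act w (a_ t)) (a_ s).
    have d' : a_ s \notin inv (w * s_ t)%g by rewrite mem_inv_cover // lE eqxx andbF.
    move=> _ x /(proj_supp (proj_skip_inv pr' d')) sx.
    by rewrite lE eul_simple_l ?sx //; case/andP: uq.
  move=> lv x xv'; have d' : a_ s \in inv (w * s_ t)%g by rewrite mem_inv_cover // d eq_sym.
  have pl := cover_label_pos R HC cv.
  have sl : supp (s :: q) (- act w (a_ t)) by apply: proj_supp (proj_take d pr) lv.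
  have [->|nx] := eqVneq x (a_ s).
    by rewrite eul_simple_r // oppr_le0 (posroot_ge0 s (posroot_refl HC pl ne)).
  have [v2 vE] := proj_take_inv pr' d'; rewrite mulgA => pr2.
  have sx : supp (s :: q) x by apply: proj_supp pr' xv'.
  have px := inv_posroot HC xv'.
  rewrite -(eul_rot C uq) // -label_refl; apply: (IH _ t v2) => //.
  - by rewrite uniq_rot1.
  - exact: covers_refl.
  - by rewrite label_refl -mem_inv_take.
  - by rewrite -mem_inv_take // -vE.
- move=> lv x xv'; have d' : a_ s \notin inv (w * s_ t)%g by rewrite mem_inv_cover // (negbTE d).
  have pr2 := proj_skip_inv pr' d'; have sx := proj_supp pr2 xv'.
  have /andP [sq uq'] := uq.
  by rewrite eul_cons0 ?sx // (IH uq' t v').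
Qed.

(** For the final letter [s], the Euler product of the label with [a_ s] is the [s]-coordinate of
    the label. It is at most 0 by [proj_label_orth] once [a_ s] is an inversion of the projection of
    [w * s_ t]; otherwise [proj_dual_cone] with [k = a_ s] would show that [a_ s] is not an
    inversion of [w * s_ t]. *)
Lemma proj_label_final s q w v t : proj (rcons q s) w v -> uniq (s :: q) ->
  covers C w t -> - act w (a_ t) \in inv v -> a_ s \in inv (w * s_ t)%g ->
  (- act w (a_ t)) 0 s <= 0.
Proof.
move=> pr uq cv lv d; have [v' pr'] := proj_exists (rcons q s) (w * s_ t)%g.
have /andP [sq _] := uq.
rewrite -(@eul_rcons_r _ _ _ C s q) //.
apply: (proj_label_orth pr _ cv pr' lv); rewrite ?uniq_rot1 //.
apply: contraT => nv; have : a_ s \notin inv (w * s_ t)%g; last by rewrite d.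
rewrite notin_inv ?posroot_simple //; apply: (proj_dual_cone pr').
- by rewrite uniq_rot1.
- exact: nonneg_simple.
- by apply: supp_simple; rewrite mem_rcons mem_head.
- move=> x xv; have px := inv_posroot HC xv; have sx := proj_supp pr' xv.
  rewrite eul_rcons_l //; last exact/supp_rcons.
  rewrite oppr_le0; apply: (posroot_ge0 s (posroot_refl HC px _)).
  by apply: contraNneq nv => <-.
Qed.

End Projection.

(** * Labels of stable covers *)

(* Equations between vectors are outside the fragment of [lra]. *)
Ltac vlra :=
  repeat match goal with H : ?x = _ |- _ =>
    let T := type of x in let T' := eval hnf in T in
    match T' with matrix _ _ _ => clear H end end; lra.

Section Stability.
Variables (R : realFieldType) (W : finGroupType) (n : nat).
Variables (C : coxeterSystem W n) (HC : simply_laced C).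
Implicit Types (x y z b : 'rV[R]_n) (i j s t : 'I_n) (q : seq 'I_n) (u v w : W).
Local Notation K := (form C).
Local Notation a_ i := (simple_root R i).
Local Notation rf i := (refl C (simple_root R i)).
Local Notation s_ := (cox_s C).
Local Notation len := (cox_length C).
Local Notation act := (act C).
Local Notation Phi := (roots C R).
Local Notation inv := (inv C R).
Local Notation pos := (posroot C).
Local Notation eul := (eul C).
Local Notation om := (om C).
Local Notation proj := (proj R C).

(** Alignment tested only where [b] is the middle root of a rank-two subsystem. For the label of a
    cover the subsystems in which [b] is simple impose nothing more; see [aligned_of_stable]. *)
Definition stable q w b : Prop :=
  forall x y, pos x -> pos y -> x + y = b -> 0 < om q x y -> x \in inv w.

(* In terms of quiver representations, [0 < eul q z b] means that there is a
   nonzero morphism from the indecomposable of dimension [b] to that of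
   dimension [z]. *)
Definition hom_size q b : nat :=
  size [seq z <- Phi | [&& pos z, [forall i, (i \notin q) ==> (z 0 i == 0)]
                          & 0 < eul q z b]].

Lemma suppP q z : reflect (supp q z) [forall i, (i \notin q) ==> (z 0 i == 0)].
Proof.
apply: (iffP forallP) => h i; first by move=> iq; have := h i; rewrite iq => /eqP.
by apply/implyP => /h ->.
Qed.

(** The reflection preserves the Euler form, and [z = a_ s] is excluded because its Euler product
    with [rf s b] is [- b 0 s]. *)
Lemma hom_size_rot_mem s q b z : uniq (s :: q) -> supp (s :: q) b -> 0 <= b 0 s ->
  [&& pos z, [forall i, (i \notin rcons q s) ==> (z 0 i == 0)]
    & 0 < eul (rcons q s) z (rf s b)] ->
  [&& pos (rf s z), [forall i, (i \notin s :: q) ==> ((rf s z) 0 i == 0)]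
    & 0 < eul (s :: q) (rf s z) b].
Proof.
move=> uq sb b0 /and3P [pz /suppP /supp_rcons sz hz].
have sb' := supp_refl C (mem_head s q) sb; have sz' := supp_refl C (mem_head s q) sz.
have nz : z != a_ s.
  apply: contraTneq hz => ->; rewrite eul_rcons_l // reflK -leNgt oppr_le0 //.
apply/and3P; split; first exact: posroot_refl.
  exact/suppP.
by rewrite -(eul_rot C uq) // reflK.
Qed.

Lemma hom_size_rot s q b : uniq (s :: q) -> supp (s :: q) b -> 0 <= b 0 s ->
  (hom_size (rcons q s) (rf s b) <= hom_size (s :: q) b)%N.
Proof.
move=> uq sb b0; rewrite /hom_size -(size_map (rf s)).
apply: uniq_leq_size.
  by rewrite map_inj_uniq ?filter_uniq ?undup_uniq //; exact: inv_inj (@reflK _ _ _ C s).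
move=> _ /mapP [z hz ->]; move: hz; rewrite !mem_filter => /andP [hz zr].
by rewrite hom_size_rot_mem // root_refl.
Qed.

(** The count for [s :: q] includes [a_ s], whose Euler product with [b] is [b 0 s], and [a_ s] is
    not the reflection of a positive root. *)
Lemma hom_size_rot_lt s q b : uniq (s :: q) -> supp (s :: q) b -> 0 < b 0 s ->
  (hom_size (rcons q s) (rf s b) < hom_size (s :: q) b)%N.
Proof.
move=> uq sb b0; apply: (@size_lt_refl _ _ _ C s).
- by rewrite filter_uniq ?undup_uniq.
- rewrite mem_filter root_simple // andbT; apply/and3P; split.
  + exact: posroot_simple.
  + by apply/suppP/supp_simple; rewrite mem_head.
  + by rewrite eul_simple_l //; case/andP: uq.
move=> z; rewrite mem_filter => /andP [hz zr]; split.
  by case/and3P: hz => pz _ _; exact: posroot_neqN pz.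
by rewrite mem_filter hom_size_rot_mem ?(ltW b0) // root_refl.
Qed.

Lemma hom_size_add s q b : s \notin q ->
  (hom_size (rcons q s) b <= hom_size (rcons q s) (b + a_ s))%N.
Proof.
move=> sq; rewrite /hom_size !size_filter; apply: sub_count => z /and3P [pz sz hz].
rewrite /= pz sz (linD (eul_linr C (rcons q s) z)) eul_rcons_r //=.
by rewrite ltr_pwDl // (posroot_ge0 s pz).
Qed.

(** Carries a decomposition back through the rotation. As [a_ s] comes last for [rcons q s], it
    cannot be [x]; the case [y = a_ s] is left to the applications. *)
Lemma decomp_rcons s q x y : uniq (s :: q) -> supp (s :: q) (x + y) -> pos x -> pos y ->
  0 < om (rcons q s) x y ->
  x != a_ s /\ (y != a_ s ->
    [/\ pos (rf s x), pos (rf s y) & 0 < om (s :: q) (rf s x) (rf s y)]).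
Proof.
move=> uq sxy px py o; have sx := supp_addl px py sxy; have sy := supp_addr px py sxy.
have nx : x != a_ s.
  apply: contraTneq o => xE; have [->|ny] := eqVneq y (a_ s).
    by rewrite xE om_same ltxx.
  by rewrite xE -leNgt om_rcons_le0.
split=> // ny; split; try exact: posroot_refl.
by rewrite -om_rot'.
Qed.

Lemma stable_refl s q w b : uniq (s :: q) -> supp (s :: q) b -> b \in inv w ->
  a_ s \in inv w -> stable (s :: q) w b -> stable (rcons q s) (s_ s * w)%g (rf s b).
Proof.
move=> uq sb bw sw st x y px py xy o.
have sb' := supp_refl C (mem_head s q) sb.
have [nx h] : x != a_ s /\ (y != a_ s ->
    [/\ pos (rf s x), pos (rf s y) & 0 < om (s :: q) (rf s x) (rf s y)]).
  by apply: decomp_rcons; rewrite ?xy.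
rewrite -mem_inv_s //; have [yE|/h [px' py' o']] := eqVneq y (a_ s).
  have xE : rf s x = b + a_ s.
    by rewrite -[b](@reflK _ _ _ C s) -xy yE reflD refl_simple subrK.
  (* Here [rf s x] is the sum of the inversions [b] and [a_ s] of [w]. *)
  by rewrite xE inv_add // -xE root_refl // posroot_root.
by apply: (st _ (rf s y)) => //; rewrite -reflD xy reflK.
Qed.

Lemma stable_refl0 s q w b : uniq (s :: q) -> supp (s :: q) b -> K b (a_ s) = 0 ->
  stable (s :: q) w b -> pos b -> stable (rcons q s) (s_ s * w)%g b.
Proof.
move=> uq sb Kb st pb x y px py xy o.
have [nx h] : x != a_ s /\ (y != a_ s ->
    [/\ pos (rf s x), pos (rf s y) & 0 < om (s :: q) (rf s x) (rf s y)]).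
  by apply: decomp_rcons; rewrite ?xy.
have ny : y != a_ s.
  have xyr : x + y \in Phi by rewrite xy posroot_root.
  have Kxy := form_sum_root (posroot_root px) (posroot_root py) xyr.
  apply/eqP => yE; move: Kb.
  by rewrite -xy formDl -yE (root_norm (posroot_root py)) Kxy; vlra.
have [px' py' o'] := h ny.
rewrite -mem_inv_s //; apply: (st _ (rf s y)) => //.
by rewrite -reflD xy /refl formC Kb scale0r subr0.
Qed.

(** The conclusion of [stable_label], isolated so that it can also serve as the induction hypothesis
    of the next section. *)
Definition label_projected q w t : Prop := forall v, covers C w t ->
  supp q (- act w (a_ t)) -> stable q w (- act w (a_ t)) -> proj q w v ->
  - act w (a_ t) \in inv v.

(** * The initial letter occurs in the label without being a descent: a contradiction *)

Section InitialLetter.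
Variables (s : 'I_n) (q : seq 'I_n) (w : W) (t : 'I_n).
Let b := - act w (a_ t).
Hypotheses (uq : uniq (s :: q)) (cv : covers C w t) (sb : supp (s :: q) b).
Hypotheses (st : stable (s :: q) w b) (nw : a_ s \notin inv w) (b0 : 0 < b 0 s).
Hypothesis IH : forall w' t',
  (hom_size (rcons q s) (- act w' (a_ t')) < hom_size (s :: q) b)%N ->
  label_projected (rcons q s) w' t'.

Let pb : pos b. Proof. exact: cover_label_pos. Qed.
Let br : b \in Phi. Proof. exact: posroot_root pb. Qed.
Let bw : b \in inv w. Proof. exact: label_inv. Qed.
Let nb : b != a_ s. Proof. by apply: contraNneq nw => <-. Qed.
Let sq : s \notin q. Proof. by case/andP: uq. Qed.
Let uq' : uniq (rcons q s). Proof. by rewrite uniq_rot1. Qed.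
Let sb' : supp (s :: q) (rf s b). Proof. exact: supp_refl (mem_head s q) sb. Qed.
Let pb' : pos (rf s b). Proof. exact: posroot_refl. Qed.

Lemma form_label_neq1 : K b (a_ s) <> 1.
Proof.
move=> Kb; have bE : rf s b = b - a_ s by rewrite /refl formC Kb scale1r.
(* The [om]-value of [a_ s] and [rf s b] is [2 * b 0 s - 1], which integrality makes positive. *)
have b1 : 1 <= b 0 s by apply: isint_ge1 => //; apply: isint_root; eassumption.
move/negP: nw; apply; apply: (st (y := rf s b)); rewrite ?posroot_simple //.
  by rewrite bE addrC subrK.
rewrite /om eul_simple_l // eul_simple_r // reflK opprK.
by rewrite refl_coord_eq Kb; vlra.
Qed.

Lemma form_label_neq0 : K b (a_ s) <> 0.
Proof.
move=> Kb; have bE : rf s b = b by rewrite /refl formC Kb scale0r subr0.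
have cv' : covers C (s_ s * w)%g t := covers_refl HC cv nb.
have lE : - act (s_ s * w)%g (a_ t) = b by rewrite label_refl.
have [v pv] := proj_exists R HC (rcons q s) (s_ s * w)%g.
have lv : - act (s_ s * w)%g (a_ t) \in inv v.
  apply: IH => //; rewrite lE.
  - by have := hom_size_rot_lt uq sb b0; rewrite bE.
  - exact/supp_rcons.
  - exact: stable_refl0.
have := proj_label_final HC pv uq cv' lv; rewrite lE mem_inv_cover // lE.
by rewrite simple_in_inv_s // eq_sym nb leNgt b0 => /(_ isT).
Qed.

Lemma form_label_neqN1 : K b (a_ s) <> -1.
Proof.
move=> Kb; set b' := rf s b.
have sb1 : supp (s :: q) b' := sb'.
have pb1 : pos b' := pb'.
have bE : b' = b + a_ s by rewrite /b' /refl formC Kb scaleN1r opprK.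
have rb' : rf s b' = b by rewrite /b' reflK.
have b's : b' 0 s = b 0 s + 1 by rewrite bE mxE simple_coord1.
(* [B] is [b 0 s + b' 0 s], the value of [om (rcons q s)] on [b] and [a_ s]. *)
set B := 2 * b 0 s + 1; have B0 : 0 < B by rewrite /B addr_gt0 // mulr_gt0.
have oba : om (rcons q s) b (a_ s) = B.
  by rewrite /om eul_rcons_r // eul_rcons_l // -/b' b's /B; vlra.
have ob'b : om (rcons q s) b' b = - B.
  rewrite om_anti bE (linD (om_linr C (rcons q s) b)) om_same oba; vlra.
pose h : 'rV[R]_n -> R := wall C w t; have lh : lin h by exact: lin_wall.
have hb : h b = 0 by rewrite (linN lh) /h wall_label // oppr0.
set al := h (a_ s); have al0 : 0 < al by apply: wall_notin; rewrite ?posroot_simple.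
(* The coefficients make [f] vanish on [b], hence on [a_ s]; [f] is invariant
   under [s] and negative on the first summands of decompositions of [b']. *)
set f := fun z => B * h (rf s z) + al * om (rcons q s) b' z.
have lf : lin f by apply: lin_comb; [exact: lin_refl | exact: om_linr].
have fb : f b = 0.
  by rewrite /f -/b' bE (linD lh) hb -bE ob'b -/al; vlra.
have fb' : f b' = 0 by rewrite /f rb' hb om_same !mulr0 addr0.
have fa : f (a_ s) = 0 by move: fb'; rewrite bE (linD lf) fb add0r.
have f_refl z : f (rf s z) = f z.
  by rewrite /refl (linD lf) (linN lf) (linZ lf) fa mulr0 oppr0 addr0.
have fX x y : pos x -> pos y -> x + y = b' -> 0 < om (rcons q s) x y -> x != b -> f x < 0.
  move=> px py xy o xb.
  have [nx hy] : x != a_ s /\ (y != a_ s ->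
      [/\ pos (rf s x), pos (rf s y) & 0 < om (s :: q) (rf s x) (rf s y)]).
    by apply: decomp_rcons; rewrite ?xy.
  have ny : y != a_ s.
    apply: contraNneq xb => yE; apply/eqP/(addIr (a_ s)).
    by rewrite -bE -xy yE.
  have [px' py' o'] := hy ny.
  have xyr : rf s x + rf s y = b by rewrite -reflD xy.
  have h1 : h (rf s x) < 0.
    apply: wall_inv => //; first exact: (st px' py').
    apply/eqP => e; have := root_neq0 (posroot_root py').
    by rewrite -[rf s y](addKr (rf s x)) xyr e addNr eqxx.
  have h2 : om (rcons q s) b' x < 0.
    by rewrite om_anti -xy (linD (om_linr C _ x)) om_same add0r oppr_lt0.
  by rewrite /f ltr_wnDl ?pmulr_rlt0 // ltW // pmulr_rlt0.
(* [f] vanishes on [b], a first summand of [b' = b + a_ s], and leaves its status open. Moving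
   towards [om (rcons q s) b'], which is [- B] on [b], makes [b] an inversion, so the label [b'] is
   stable. *)
have [w1 [t1 [cv1 l1 h1]]] := cover_exists HC pb1 lf (om_linr C (rcons q s) b') fb' (om_same C _ b').
have [v1 pv1] := proj_exists R HC (rcons q s) w1.
have b'v1 : b' \in inv v1.
  rewrite l1; apply: IH => //; rewrite -l1.
  - by rewrite hom_size_rot_lt.
  - exact/supp_rcons.
  move=> x y px py xy o; have xb' : x != b'.
    apply/eqP => e; have := root_neq0 (posroot_root py).
    by rewrite -[y](addKr x) xy e addNr eqxx.
  have [c1 c2 _] := h1 x px xb'.
  have [xE|nx] := eqVneq x b; last by apply: c1; exact: fX xy o nx.
  by apply: c2; rewrite xE ?fb // ob'b oppr_lt0.
have bv1 : b \in inv v1.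
  apply: (proj_aligned HC pv1 uq' (y := a_ s)); rewrite ?posroot_simple -?bE //.
  by rewrite oba.
have f_neg x y : pos x -> pos y -> x + y = b -> 0 < om (s :: q) x y -> f x < 0.
  move=> px py xy o.
  have xyr : x + y \in Phi by rewrite xy.
  have Kxy : K x y = -1 by apply: form_sum_root => //; exact: posroot_root.
  have nx : x != a_ s.
    apply/eqP => e; move: Kb; rewrite -xy formDl -e root_norm ?posroot_root //.
    by rewrite formC Kxy; vlra.
  have ny : y != a_ s.
    apply/eqP => e; move: Kb; rewrite -xy formDl -e (root_norm (posroot_root py)).
    by rewrite Kxy; vlra.
  have sx : supp (s :: q) x by apply: supp_addl px py _; rewrite xy.
  have sy : supp (s :: q) y by apply: supp_addr px py _; rewrite xy.
  rewrite -f_refl; apply: (fX _ (rf s y)); rewrite ?posroot_refl ?om_rot //.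
    by rewrite -reflD xy.
  apply/eqP => e; have xb' : x = b' by rewrite /b' -e reflK.
  move: xy; rewrite xb' bE -addrA -[RHS]addr0 => /addrI e2.
  have := posroot_neqN s py; rewrite -[y]opprK eqr_opp eq_sym.
  by move/eqP: e2; rewrite addr_eq0 => ->.
have f_neg' x y : pos x -> pos y -> x + y = b -> 0 < om (rcons q s) x y -> f x < 0.
  move=> px py xy o.
  have sx : supp (s :: q) x by apply: supp_addl px py _; rewrite xy.
  have sy : supp (s :: q) y by apply: supp_addr px py _; rewrite xy.
  have xv1 : x \in inv v1 by apply: (proj_aligned HC pv1 uq' (y := y)); rewrite ?xy.
  have xb' : x != b'.
    apply/eqP => e; have := posroot_neqN s py; move: xy.
    rewrite e bE -addrA -[RHS]addr0 => /addrI /eqP; rewrite addr_eq0 => /eqP e2.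
    by rewrite -[y]opprK -e2 eqxx.
  have fx : f x <= 0.
    have [_ _ c3] := h1 x px xb'; rewrite leNgt; apply/negP => /c3.
    by rewrite (proj_sub HC pv1).
  have o0 : om (s :: q) x y != 0.
    by apply: om_neq0 => //; rewrite ?xy //; exact: posroot_root.
  (* If [y] is the first summand for [s :: q], then [f y < 0], and [f x + f y = f b = 0] contradicts
     [f x <= 0]. *)
  case: (ltrgt0P (om (s :: q) x y)) => o1; last by rewrite o1 eqxx in o0.
    exact: f_neg o1.
  have fy : f y < 0 by apply: (f_neg y x); rewrite // 1?addrC // om_anti oppr_gt0.
  by move: fb; rewrite -xy (linD lf); vlra.
(* The vector [b + 2 *: a_ s] is orthogonal to [b] and has product 3 with [a_ s]. Moving towards
   [f2] thus stays on the wall of [b] and makes [a_ s] an inversion. *)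
set f2 := fun z => - K z (b + 2 *: a_ s).
have lf2 : lin f2 by move=> c x y; rewrite /f2 formDl formZl; ring.
have f2b : f2 b = 0 by rewrite /f2 formDr formZr Kb root_norm //; ring.
have f2a : f2 (a_ s) < 0 by rewrite /f2 formDr formZr (formC C _ b) Kb form_simpleii; vlra.
have [w2 [t2 [cv2 l2 h2]]] := cover_exists HC pb lf lf2 fb f2b.
have [v2 pv2] := proj_exists R HC (rcons q s) w2.
have bv2 : - act w2 (a_ t2) \in inv v2.
  apply: IH => //; rewrite -l2.
  (* The label is [b] and not [rf s b], but [rf s b = b + a_ s] has at least the same count for
     [rcons q s]. *)
  - apply: leq_ltn_trans (hom_size_rot_lt uq sb b0).
    by rewrite -/b' bE hom_size_add.
  - exact/supp_rcons.
  move=> x y px py xy o; have xb : x != b.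
    apply/eqP => e; have := root_neq0 (posroot_root py).
    by rewrite -[y](addKr x) xy e addNr eqxx.
  by have [c1 _ _] := h2 x px xb; apply: c1; exact: f_neg' xy o.
have := proj_label_final HC pv2 uq cv2 bv2; rewrite -l2 mem_inv_cover // -l2.
rewrite (eq_sym _ b) nb leNgt b0 andbT.
have [|_ c2 _] := h2 (a_ s) (posroot_simple R HC s); first by rewrite eq_sym.
by rewrite c2 // => /(_ isT).
Qed.

Lemma stable_initial_false : False.
Proof.
have n2 : b != - a_ s by exact: (posroot_neqN s pb).
have := form_root_cases HC br (root_simple R HC s) nb n2.
by case; [exact: form_label_neqN1 | exact: form_label_neq0 | exact: form_label_neq1].
Qed.

End InitialLetter.

Theorem stable_label q w t : uniq q -> label_projected q w t.
Proof.
(* Lexicographic induction on the size of [q], [hom_size] and the length of [w]. Skipping a letter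
   lowers the first, changing the wall lowers the second and keeps the first, and taking a letter
   lowers the length without raising the others. *)
have [N] := ubnP (size q); elim: N q w t => // N IHN q w t; rewrite ltnS => sz.
have [M] := ubnP (hom_size q (- act w (a_ t))).
elim: M q w t sz => // M IHM q w t sz; rewrite ltnS.
have [L] := ubnP (len w); elim: L q w t sz => // L IHL q w t sz; rewrite ltnS => lw hM uq.
move=> v cv sb st pv; set b := - act w (a_ t) in hM sb st *.
have pb : pos b by exact: cover_label_pos.
have bw : b \in inv w by exact: label_inv.
case: q sz uq hM sb st pv => [|s q] sz uq hM sb st pv.
  have := root_neq0 (posroot_root pb); rewrite (_ : b = 0) ?eqxx //.
  by apply/rowP => i; rewrite [RHS]mxE; exact: sb.
have [d|d] := boolP (a_ s \in inv w).
  have [v' vE pv'] := proj_take_inv pv d.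
  have vs := simple_notin_proj HC d pv'.
  have [->|ne] := eqVneq b (a_ s); first by rewrite vE; exact: simple_in_inv_s.
  rewrite vE mem_inv_take // -label_refl //.
  apply: (IHL (rcons q s)) => //; rewrite ?label_refl ?uniq_rot1 ?size_rcons //.
  - by rewrite left_descent // in d; exact: leq_trans d lw.
  - apply: leq_trans hM; apply: hom_size_rot => //; exact: (posroot_ge0 s pb).
  - exact: (covers_refl HC cv ne).
  - by apply/supp_rcons/supp_refl => //; rewrite mem_head.
  - exact: stable_refl.
have pv' := proj_skip_inv pv d; have /andP [sq uq'] := uq.
have [b0|b0] := eqVneq (b 0 s) 0.
  apply: (IHN q) => //; first exact: supp_cons0 sb b0.
  move=> x y px py xy o; apply: (st x y) => //.
  have sx : x 0 s = 0 by have := posroot_ge0 s px; have := posroot_ge0 s py;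
    have := congr1 (fun z => z 0 s) xy; rewrite mxE b0; vlra.
  have sy : y 0 s = 0 by have := congr1 (fun z => z 0 s) xy; rewrite mxE b0 sx add0r.
  by move: o; rewrite /om !eul_cons0.
exfalso; apply: (stable_initial_false uq cv sb st d) => //.
  by rewrite lt_neqAle eq_sym b0; exact: (posroot_ge0 s pb).
move=> w' t' lt; apply: IHM; rewrite ?size_rcons ?uniq_rot1 //.
exact: leq_trans lt hM.
Qed.

End Stability.

(** * Maximality of the projection and rank two subsystems *)

Section Alignment.
Variables (R : realFieldType) (W : finGroupType) (n : nat).
Variables (C : coxeterSystem W n) (HC : simply_laced C).
Implicit Types (x y z b : 'rV[R]_n) (i j s t : 'I_n) (q : seq 'I_n) (u v w : W).
Local Notation K := (form C).
Local Notation a_ i := (simple_root R i).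
Local Notation s_ := (cox_s C).
Local Notation len := (cox_length C).
Local Notation act := (act C).
Local Notation Phi := (roots C R).
Local Notation inv := (inv C R).
Local Notation pos := (posroot C).
Local Notation om := (om C).
Local Notation proj := (proj R C).

(** A right descent [t] of [v^-1 * w] works. If [- act w (a_ t)] were negative, its opposite would
    be an inversion of [v], hence of [w], although [w^-1] sends it to [a_ t]. *)
Lemma weak_cover v w : {subset inv v <= inv w} -> v != w ->
  exists t, covers C w t /\ - act w (a_ t) \notin inv v.
Proof.
move=> sub ne; have /(descent_exists C) [t /(covers_neg R HC) d] : (v^-1 * w)%g != 1%g.
  by rewrite -eq_invg_mul invgK.
have lr : - act w (a_ t) \in Phi by rewrite rootN // root_act // root_simple.
have vl : nonneg (act v^-1%g (- act w (a_ t))).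
  by rewrite actN -actM // .
have pl : pos (- act w (a_ t)).
  rewrite /posroot lr; case: (root_sign HC lr) => // h; exfalso.
  have : - - act w (a_ t) \in inv w.
    by apply: sub; rewrite mem_inv // /posroot rootN // h actN // opprK.
  rewrite opprK mem_inv // actK // => /andP [_].
  by rewrite (negbTE (root_not_neg (root_simple R HC t) (nonneg_simple R t))).
exists t; split; last by rewrite notin_inv.
by apply/(covers_neg R HC); case/andP: pl.
Qed.

(* An aligned element below [w] whose inversions contain the label of a cover
   of [w] makes that cover stable, so the label belongs to the projection. *)
Lemma proj_max q w v v' : uniq q -> proj q w v -> proj q v' v' ->
  {subset inv v' <= inv w} -> {subset inv v' <= inv v}.
Proof.
move=> uq; have [k] := ubnP (len w); elim: k w v => // k IH w v; rewrite ltnS.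
move=> lw pv pv' sub; have [->//|ne] := eqVneq v w.
have [t [cv nl]] := weak_cover (proj_sub HC pv) ne.
have [lv'|nl'] := boolP (- act w (a_ t) \in inv v').
  case/negP: nl; apply: (stable_label HC uq) cv _ _ pv.
    exact: (proj_supp HC pv' lv').
  by move=> x y px py xy o; apply: sub; apply: (proj_aligned HC pv' uq (y := y)); rewrite ?xy.
have [v2 pv2] := proj_exists R HC q (w * s_ t)%g.
rewrite -(proj_contract HC pv cv pv2 nl).
apply: IH pv2 pv' _; first exact: leq_trans cv lw.
move=> x xv; rewrite mem_inv_cover // sub //=.
by apply: contraNneq nl' => <-.
Qed.

Lemma inv_inj v w : inv v =i inv w -> v = w.
Proof.
move=> e; apply/eqP; apply: contraT => ne.
have [|t [cv]] := @weak_cover v w _ ne; first by move=> x; rewrite e.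
by rewrite e label_inv.
Qed.

(** * Comparison of the Euler forms, and roots in a plane *)

Variable pi : 'S_n.
Local Notation cw := (cox_word pi).

Lemma uniq_cox_word : uniq cw.
Proof. by rewrite map_inj_uniq ?enum_uniq //; exact: perm_inj. Qed.

Lemma mem_cox_word i : i \in cw.
Proof. by apply/mapP; exists ((pi^-1)%g i); rewrite ?mem_enum ?permKV. Qed.

Lemma supp_cox_word x : supp cw x.
Proof. by move=> i; rewrite mem_cox_word. Qed.

(** Unfolds the recursion of [eul] into the double sum of [euler_mx], with [p] giving the positions:
    pairs whose left entry is the first letter and whose right entry is a later one contribute 0. *)
Lemma eul_sum (p : 'I_n -> nat) q x y :
  pairwise (fun i j => p i < p j)%N q ->
  eul C q x y = \sum_(i <- q) \sum_(j <- q) x 0 i * y 0 j *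
    (if (p j < p i)%N then cox_mx C R i j else if p i == p j then 1 else 0).
Proof.
elim: q => [|s q IH] /=; first by rewrite big_nil.
move=> /andP [/allP sq pq]; rewrite !big_cons ltnn eqxx mulr1 IH //.
set e := fun i j => if (p j < p i)%N then cox_mx C R i j else if p i == p j then 1 else 0.
have e1 j : j \in q -> e s j = 0.
  by move=> /sq lt; rewrite /e ltnNge (ltnW lt) /= ltn_eqF.
have e2 i : i \in q -> e i s = cox_mx C R i s by move=> /sq lt; rewrite /e lt.
rewrite [X in _ = _ + X + _]big1_seq => [|j /andP [_ jq]]; last by rewrite -/(e s j) e1 ?mulr0.
rewrite addr0 [X in _ = _ + X](eq_big_seq (fun i => y 0 s * (x 0 i * cox_mx C R i s) +
  \sum_(j <- q) x 0 i * y 0 j * e i j)) => [|i iq]; last first.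
  by rewrite big_cons -/(e i s) e2 //; ring.
by rewrite big_split -mulr_sumr /=; ring.
Qed.

Lemma euler_eul x y : euler C pi x y = eul C cw x y.
Proof.
rewrite (@eul_sum (fun i => (pi^-1)%g i)); last first.
  rewrite pairwise_map; have : pairwise ltn (map val (enum 'I_n)).
    by rewrite val_enum_ord -(sorted_pairwise ltn_trans) iota_ltn_sorted.
  by rewrite pairwise_map; apply: sub_pairwise => i j /=; rewrite !permK.
have sum_cw (F : 'I_n -> R) : \sum_(i <- cw) F i = \sum_i F i.
  by rewrite big_map big_enum [RHS](reindex_inj (@perm_inj _ pi)).
rewrite sum_cw /euler mxE.
under eq_bigr => j _ do rewrite mxE mulr_suml.
rewrite exchange_big; apply: eq_bigr => i _; rewrite sum_cw; apply: eq_bigr => j _.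
by rewrite !mxE /=; case: ifP => _; [ring | rewrite -val_eqE; case: ifP => _; ring].
Qed.

Lemma omega_om x y : omega C pi x y = om cw x y.
Proof. by rewrite /omega !euler_eul. Qed.

Lemma root_reflr x y : x \in Phi -> y \in Phi -> refl C x y \in Phi.
Proof.
move=> /rootP [u [i ->]] yr.
have -> : refl C (act u (a_ i)) y = act (u * s_ i * u^-1)%g y; last exact: root_act.
have e : K (act u (a_ i)) y = K (a_ i) (act u^-1%g y).
  by rewrite -{1}(actVK HC u y) form_act.
by rewrite !actM // act_s // /refl actD // actN // actZ // actVK // e.
Qed.

(** Inverting the Gram matrix expresses [c] and [d] by [K z x] and [K z y]. Away from the roots [x],
    [y] and their opposites both are -1, 0 or 1, and the norm 2 of [z] forces both to be 1 or both
    to be -1. *)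
Lemma root_span2 x y z c d : x \in Phi -> y \in Phi -> z \in Phi -> K x y = -1 ->
  z = c *: x + d *: y ->
  [\/ z = x \/ z = - x, z = y \/ z = - y | z = x + y \/ z = - (x + y)].
Proof.
move=> xr yr zr Kxy zE.
have [e1|n1] := eqVneq z x; first by constructor 1; left.
have [e2|n2] := eqVneq z (- x); first by constructor 1; right.
have [e3|n3] := eqVneq z y; first by constructor 2; left.
have [e4|n4] := eqVneq z (- y); first by constructor 2; right.
have zx : K z x = 2 * c - d.
  by rewrite zE formDl !formZl root_norm // (formC C y) Kxy; ring.
have zy : K z y = 2 * d - c by rewrite zE formDl !formZl Kxy (root_norm yr); ring.
have zz : 2 * (c * c - c * d + d * d) = 2.
  transitivity (K z z); last exact: root_norm.
  by rewrite {2}zE formDr !formZr zx zy; ring.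
constructor 3.
have cE : c = (2 * K z x + K z y) / 3 by rewrite zx zy; field.
have dE : d = (K z x + 2 * K z y) / 3 by rewrite zx zy; field.
have := form_root_cases HC zr xr n1 n2; have := form_root_cases HC zr yr n3 n4.
move: zz; rewrite cE dE; move=> zz h1 h2.
have hh : (K z x = 1 /\ K z y = 1) \/ (K z x = -1 /\ K z y = -1).
  by move: zz; case: h1 => ->; case: h2 => -> /eqP zz; (try by left); (try by right);
    exfalso; move: zz; apply/negP; rewrite -subr_eq0; vlra.
case: hh => -[k1 k2]; [left|right]; rewrite k1 k2 in cE dE.
  have -> : z = 1 *: x + 1 *: y by rewrite zE; congr (_ *: _ + _ *: _); vlra.
  by rewrite !scale1r.
have -> : z = -1 *: x + -1 *: y by rewrite zE; congr (_ *: _ + _ *: _); vlra.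
by rewrite !scaleN1r opprD.
Qed.

Lemma cover_labelP w t a : covers C w t -> cover_label C w t a <-> a = - act w (a_ t).
Proof.
move=> cv; set b := - act w (a_ t).
have mem x : (x \in [seq z <- inv w | z \notin inv (w * s_ t)%g]) = (x == b).
  rewrite mem_filter mem_inv_cover // negb_and negbK -/b.
  case: (eqVneq x b) => [->|_]; first by rewrite label_inv ?orbT.
  by rewrite orbF andNb.
split=> [h|-> x]; last by rewrite mem inE.
by apply/eqP; rewrite -mem h mem_head.
Qed.

(** * The rank-two subsystem spanned by a decomposition of a positive root *)

Section Decomposition.
Variables x y : 'rV[R]_n.
Hypotheses (px : pos x) (py : pos y) (pxy : pos (x + y)).
Let Kxy : K x y = -1.
Proof. by apply: form_sum_root; exact: posroot_root. Qed.

Definition plane_roots : seq 'rV[R]_n := [seq z <- Phi | z \in <<[:: x; y]>>%VS].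

Lemma mem_plane_roots z : (z \in plane_roots) = (z \in Phi) && (z \in <<[:: x; y]>>%VS).
Proof. by rewrite mem_filter andbC. Qed.

Lemma plane_roots_l : x \in plane_roots.
Proof. by rewrite mem_plane_roots posroot_root // memv_span ?mem_head. Qed.

Lemma plane_roots_r : y \in plane_roots.
Proof. by rewrite mem_plane_roots posroot_root // memv_span // !inE eqxx orbT. Qed.

Lemma span_plane_roots : <<plane_roots>>%VS = <<[:: x; y]>>%VS.
Proof.
apply/eqP; rewrite eqEsubv; apply/andP; split; apply/span_subvP => z.
  by rewrite mem_plane_roots => /andP [].
rewrite !inE => /orP [] /eqP ->; apply: memv_span.
  exact: plane_roots_l.
exact: plane_roots_r.
Qed.

Lemma dim_plane : \dim <<[:: x; y]>>%VS = 2%N.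
Proof.
have : free [:: x; y].
  rewrite free_cons span_seq1 seq1_free (root_neq0 (posroot_root py)) andbT.
  apply/negP => /vlineP [k xE]; have := root_norm (posroot_root px).
  move: Kxy; rewrite {1 2 3}xE !formZl (root_norm (posroot_root py)) => k1.
  rewrite formZr (root_norm (posroot_root py)) => k2.
  have kE : k = -1 / 2 by vlra.
  by rewrite kE in k2; vlra.
by rewrite -[2%N]/(size [:: x; y]) => /eqP <-.
Qed.

Lemma rank2_plane_roots : rank2_subsystem C plane_roots.
Proof.
have cl : rank2_closed C plane_roots.
  split.
  - by move=> z; rewrite mem_plane_roots => /andP [].
  - by rewrite span_plane_roots dim_plane.
  - move=> a b; rewrite !mem_plane_roots => /andP [ar asp] /andP [br bsp].
    by rewrite root_reflr // memvB // memvZ.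
split=> // B [Br Bd Bc] sub.
have e : <<plane_roots>>%VS = <<B>>%VS.
  apply/eqP; rewrite eqEdim Bd; have [_ -> _] := cl; rewrite andbT.
  by apply: sub_span.
move=> z; apply/idP/idP; last exact: sub.
by move=> zB; rewrite mem_plane_roots Br // -span_plane_roots e memv_span.
Qed.

Lemma noncommutative_plane_roots : noncommutative C plane_roots.
Proof.
exists x, y; split; last by rewrite Kxy oppr_eq0 oner_eq0.
have pmem z : (z \in pos_part plane_roots) = pos z && (z \in <<[:: x; y]>>%VS).
  by rewrite mem_filter mem_plane_roots /posroot /nonneg andbCA andbA.
split.
- by rewrite pmem px memv_span ?mem_head.
- by rewrite pmem py memv_span // !inE eqxx orbT.
- apply/eqP => e; move: Kxy; rewrite e (root_norm (posroot_root py)) => h.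
  by vlra.
move=> z; rewrite pmem => /andP [pz]; rewrite span_cons span_seq1.
move=> /memv_addP [_ /vlineP [c ->] [_ /vlineP [d ->] zE]].
have nneg a : pos a -> z != - a.
  move=> /andP [ar ap]; apply: contraTneq pz => ->.
  by rewrite /posroot (negbTE (root_not_neg ar ap)) andbF.
case: (root_span2 (posroot_root px) (posroot_root py) (posroot_root pz) Kxy zE) => -[] e.
- by exists 1, 0; rewrite e scale1r scale0r addr0 ler01 lexx.
- by move: (nneg x px); rewrite e eqxx.
- by exists 0, 1; rewrite e scale1r scale0r add0r ler01 lexx.
- by move: (nneg y py); rewrite e eqxx.
- by exists 1, 1; rewrite e !scale1r ler01.
- by move: (nneg _ pxy); rewrite e eqxx.
Qed.

(** In any omega order [x] precedes [x + y], which precedes [y]. So [x + y] is not last, and an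
    initial segment containing it contains [x]. *)
Lemma aligned_plane_roots w : aligned C pi w plane_roots -> x + y \in inv w ->
  0 < omega C pi x y -> x \in inv w.
Proof.
have pmem z : (z \in pos_part plane_roots) = pos z && (z \in <<[:: x; y]>>%VS).
  by rewrite mem_filter mem_plane_roots /posroot /nonneg andbCA andbA.
have sx : x \in <<[:: x; y]>>%VS by rewrite memv_span ?mem_head.
have sy : y \in <<[:: x; y]>>%VS by rewrite memv_span // !inE eqxx orbT.
have xP : x \in pos_part plane_roots by rewrite pmem px.
have yP : y \in pos_part plane_roots by rewrite pmem py.
have xyP : x + y \in pos_part plane_roots by rewrite pmem pxy memvD.
move=> [b [ub bE pb] /= al] xyw o.
have memI z : z \in [seq a <- inv w | a \in pos_part plane_roots] =
    (z \in pos_part plane_roots) && (z \in inv w) by rewrite mem_filter.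
have idx z1 z2 : z1 \in b -> z2 \in b -> (index z1 b < index z2 b)%N -> 0 < omega C pi z1 z2.
  move=> m1 m2 lt; have := pairwiseP 0 pb (index z1 b) (index z2 b).
  by rewrite !inE !index_mem !nth_index //; apply.
have xb : x \in b by rewrite bE.
have yb : y \in b by rewrite bE.
have xyb : x + y \in b by rewrite bE.
have o1 : omega C pi x (x + y) = omega C pi x y.
  by rewrite !omega_om (linD (om_linr C cw x)) om_same add0r.
have o2 : omega C pi y (x + y) = - omega C pi x y.
  by rewrite !omega_om (linD (om_linr C cw y)) om_same addr0 om_anti.
have anti z1 z2 : omega C pi z1 z2 = - omega C pi z2 z1 by rewrite !omega_om om_anti.
have x0 := root_neq0 (posroot_root px); have y0 := root_neq0 (posroot_root py).
have nx : x != x + y by rewrite -subr_eq0 opprD addNKr oppr_eq0.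
have ny : y != x + y by rewrite eq_sym -subr_eq0 addrK.
have lt1 : (index x b < index (x + y)%R b)%N.
  case: (ltngtP (index x b) (index (x + y)%R b)) => //.
    by move=> /(idx _ _ xyb xb); rewrite anti o1; vlra.
  by move=> e; case/eqP: nx; have := congr1 (nth 0 b) e; rewrite !nth_index.
have lt2 : (index (x + y)%R b < index y b)%N.
  case: (ltngtP (index (x + y)%R b) (index y b)) => //.
    by move=> /(idx _ _ yb xyb); rewrite o2; vlra.
  by move=> e; case/eqP: ny; have := congr1 (nth 0 b) e; rewrite !nth_index.
have xyI : x + y \in [seq a <- inv w | a \in pos_part plane_roots] by rewrite memI xyP.
case: al => [I0|I1|[k Ik]].
- by move: xyI; rewrite I0.
- have il : index (last 0 b) b = (size b).-1.
    by case: (b) ub => [|z b'] // ub'; exact: (index_last ub').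
  move: xyI; rewrite I1 inE => /eqP e; move: lt2; rewrite e il.
  by move: yb; rewrite -index_mem; case: (size b) => // m; rewrite ltnS /= leqNgt => /negbTE ->.
- move: xyI; rewrite Ik (in_take _ xyb) => xyk.
  by have := Ik x; rewrite (in_take _ xb) (ltn_trans lt1 xyk) memI => /andP [].
Qed.

End Decomposition.

End Alignment.

(** * Agreement of c-stability with the stability of the label *)

Section StableCovers.
Variables (R : realFieldType) (W : finGroupType) (n : nat).
Variables (C : coxeterSystem W n) (HC : simply_laced C) (pi : 'S_n).
Implicit Types (x y z b : 'rV[R]_n) (i j s t : 'I_n) (q : seq 'I_n) (u v w : W).
Local Notation K := (form C).
Local Notation a_ i := (simple_root R i).
Local Notation s_ := (cox_s C).
Local Notation act := (act C).
Local Notation Phi := (roots C R).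
Local Notation inv := (inv C R).
Local Notation pos := (posroot C).
Local Notation om := (om C).
Local Notation cw := (cox_word pi).

(** The only other nonzero value is 1. Then [y - x] or its opposite would be a positive root of [A]
    that is not a nonnegative combination of [x] and [y]. *)
Lemma simple_pair_form A x y : rank2_closed C A -> simple_pair A x y ->
  K x y != 0 -> K x y = -1.
Proof.
move=> [sub _ cl] [xA yA ne gen] k0; move: xA yA; rewrite !mem_filter.
move=> /andP [xp xA] /andP [yp yA]; have xr := sub _ xA; have yr := sub _ yA.
have px : pos x by rewrite /posroot xr.
have py : pos y by rewrite /posroot yr.
have nN : x != - y.
  apply: contraTneq px => ->; rewrite /posroot negb_and.
  by rewrite (root_not_neg yr yp) orbT.
case: (form_root_cases HC xr yr ne nN) => // [e|e]; first by rewrite e eqxx in k0.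
have no z1 z2 : z1 \in A -> z2 \in A -> K z1 z2 = 1 -> nonneg (z2 - z1) ->
    (forall z, z \in pos_part A -> exists c d : R,
      [/\ 0 <= c, 0 <= d & z = c *: z1 + d *: z2]) -> K z1 z2 = -1.
  move=> m1 m2 k1 p gen'; exfalso.
  have m : z2 - z1 \in A by have := cl _ _ m1 m2; rewrite /refl k1 scale1r.
  have [|c [d [c0 d0 vE]]] := gen' (z2 - z1); first by rewrite mem_filter m andbT.
  have e1 : K (z2 - z1) z1 = 2 * c + d.
    by rewrite vE formDl !formZl (root_norm (sub _ m1)) (formC C z2) k1; ring.
  have e2 : K (z2 - z1) z2 = c + 2 * d.
    by rewrite vE formDl !formZl (root_norm (sub _ m2)) k1; ring.
  move: e1 e2; rewrite !formDl !formNl (formC C z2 z1) k1 !root_norm ?sub // => e1 e2.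
  by vlra.
have xyr : refl C x y \in Phi by apply/sub/cl.
case: (root_sign HC xyr) => h; rewrite /refl e scale1r in h.
  exact: (no x y xA yA e h gen).
rewrite opprB in h; rewrite formC in e.
rewrite formC; apply: (no y x yA xA e h).
by move=> z /gen [c [d [c0 d0 ->]]]; exists d, c; rewrite addrC.
Qed.

(** The positive roots are [x], [x + y], [y] in this order. Closure of inversion sets and of their
    complements leaves, besides the aligned patterns, only the one consisting of [x + y] and [y]. *)
Lemma aligned_of_stable w t A : covers C w t -> stable C cw w (- act w (a_ t)) ->
  rank2_subsystem C A -> noncommutative C A -> - act w (a_ t) \in A ->
  aligned C pi w A.
Proof.
move=> cv st [cA _] [x0 [y0 [sp0 k0]]] bA; have cA' := cA.
have [x [y [sp Kxy o]]] : exists x y, [/\ simple_pair A x y, K x y = -1 & 0 < om cw x y].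
  have K0 := simple_pair_form cA sp0 k0; have [sub _ cl] := cA.
  have [xA yA ne gen] := sp0.
  have xr : x0 \in Phi by apply: sub; move: xA; rewrite mem_filter => /andP [].
  have yr : y0 \in Phi by apply: sub; move: yA; rewrite mem_filter => /andP [].
  have xyr : x0 + y0 \in Phi.
    have := root_reflr HC xr yr; rewrite /refl K0 scaleN1r opprK addrC //.
  have := om_neq0 (uniq_cox_word pi) xr yr xyr (supp_cox_word _) (supp_cox_word _).
  case: (ltrgt0P (om cw x0 y0)) => // o _; first by exists x0, y0.
  exists y0, x0; split; last by rewrite om_anti oppr_gt0.
    split; rewrite 1?eq_sym // => v /gen [c [d [c0 d0 ->]]].
    by exists d, c; rewrite addrC.
  by rewrite formC.
have [sub _ cl] := cA; have [xP yP ne gen] := sp.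
have /andP [xp xA] : nonneg x && (x \in A) by rewrite mem_filter in xP.
have /andP [yp yA] : nonneg y && (y \in A) by rewrite mem_filter in yP.
have px : pos x by rewrite /posroot sub.
have py : pos y by rewrite /posroot sub.
have xyA : x + y \in A by have := cl _ _ xA yA; rewrite /refl Kxy scaleN1r opprK addrC.
have pxy : pos (x + y) by rewrite /posroot sub // nonnegD.
have x00 := root_neq0 (sub _ xA); have y00 := root_neq0 (sub _ yA).
have nx : x != x + y by rewrite -subr_eq0 opprD addNKr oppr_eq0.
have ny : x + y != y by rewrite -subr_eq0 addrK.
have PE z : (z \in pos_part A) = (z \in [:: x; x + y; y]).
  apply/idP/idP; last first.
    by rewrite !inE => /or3P [] /eqP -> //; rewrite mem_filter xyA andbT; case/andP: pxy.
  move=> zP; have [c [d [_ _ zE]]] := gen z zP.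
  move: zP; rewrite mem_filter => /andP [zp zA]; have pz : pos z by rewrite /posroot sub.
  have nneg a : pos a -> z != - a.
    move=> /andP [ar ap]; apply: contraTneq pz => ->.
    by rewrite /posroot (negbTE (root_not_neg ar ap)) andbF.
  have := root_span2 HC (sub _ xA) (sub _ yA) (sub _ zA) Kxy zE.
  rewrite !inE; case=> -[] e; rewrite ?e ?eqxx ?orbT //.
  - by move: (nneg x px); rewrite e eqxx.
  - by move: (nneg y py); rewrite e eqxx.
  - by move: (nneg _ pxy); rewrite e eqxx.
have pb := cover_label_pos R HC cv; set b := - act w (a_ t) in st bA pb.
have bP : b \in [:: x; x + y; y].
  by rewrite -PE mem_filter bA andbT; case/andP: pb.
have bw : b \in inv w by exact: label_inv.
have o1 : om cw x (x + y) = om cw x y by rewrite (linD (om_linr C cw x)) om_same add0r.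
have o2 : om cw (x + y) y = om cw x y.
  by rewrite om_anti (linD (om_linr C cw y)) om_same addr0 -om_anti.
exists [:: x; x + y; y].
  split; [|by move=> z; rewrite PE|].
    by rewrite /= !inE !negb_or nx ne ny.
  by rewrite /= !omega_om // o1 o2 o.
have memI z : z \in [seq a <- inv w | a \in pos_part A] =
    (z \in inv w) && (z \in [:: x; x + y; y]) by rewrite mem_filter PE andbC.
have c1 : x \in inv w -> y \in inv w -> x + y \in inv w.
  by move=> h1 h2; apply: inv_add => //; exact: sub.
have c2 : x + y \in inv w -> (x \in inv w) || (y \in inv w) by exact: inv_add_or.
(* Excludes that pattern: a label [x] is itself an inversion, a label [x + y] is covered by
   stability, and for a label [y] the element [w * s_ t] would have the inversion [x + y] but
   neither summand. *)
have c3 : x + y \in inv w -> y \in inv w -> x \in inv w.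
  move=> h1 h2; apply: contraT => h3; move: bP; rewrite !inE => /or3P [] /eqP e.
  - by move: bw; rewrite e (negbTE h3).
  - by rewrite (st x y) // in h3.
  have : x + y \in inv (w * s_ t)%g by rewrite mem_inv_cover // h1 -/b e.
  by move/(inv_add_or HC px py); rewrite !mem_inv_cover // (negbTE h3) -/b e eqxx andbF.
move: c1 c2 c3.
have [hx|hx] := boolP (x \in inv w); have [hxy|hxy] := boolP (x + y \in inv w);
  have [hy|hy] := boolP (y \in inv w) => c1 c2 c3;
  try by [case: (notF (c1 isT isT)) | case: (notF (c2 isT)) | case: (notF (c3 isT isT))].
- by constructor 3; exists 3%N => z; rewrite memI; apply: andb_idl; rewrite !inE => /or3P [] /eqP ->.
- constructor 3; exists 2%N => z; rewrite memI !inE.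
  by case: eqP => [->|_]; rewrite ?hx //; case: eqP => [->|_]; rewrite ?hxy //;
    case: eqP => [->|_]; rewrite ?(negbTE hy) ?andbF.
- constructor 3; exists 1%N => z; rewrite memI !inE.
  by case: eqP => [->|_]; rewrite ?hx //; case: eqP => [->|_]; rewrite ?(negbTE hxy) //;
    case: eqP => [->|_]; rewrite ?(negbTE hy) ?andbF.
- constructor 2 => z; rewrite memI !inE /=.
  case: (eqVneq z x) => [->|_]; first by rewrite (negbTE hx) (negbTE ne).
  case: (eqVneq z (x + y)) => [->|_]; first by rewrite (negbTE hxy) (negbTE ny).
  by case: eqP => [->|_]; rewrite ?hy ?andbF.
- constructor 1 => z; rewrite memI !inE.
  by case: eqP => [->|_]; rewrite ?(negbTE hx) //; case: eqP => [->|_]; rewrite ?(negbTE hxy) //;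
    case: eqP => [->|_]; rewrite ?(negbTE hy) ?andbF.
Qed.

Lemma c_stableP w t : covers C w t ->
  c_stable C R pi w t <-> stable C cw w (- act w (a_ t)).
Proof.
move=> cv; split=> [[a /(cover_labelP HC a cv) -> h] x y px py xy o|st].
  have pxy : pos (x + y) by rewrite xy; exact: cover_label_pos.
  apply: (aligned_plane_roots (pi := pi) px py pxy); rewrite ?omega_om //.
    apply: h; [exact: rank2_plane_roots | exact: noncommutative_plane_roots |].
    rewrite -xy mem_plane_roots posroot_root // memvD // memv_span //.
      exact: mem_head.
    by rewrite !inE eqxx orbT.
  by rewrite xy label_inv.
exists (- act w (a_ t)); first exact/cover_labelP.
by move=> A r2 nc bA; exact: aligned_of_stable cv st r2 nc bA.
Qed.

End StableCovers.

(** * Sorting words *)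

Section SortingWords.
Variables (R : realFieldType) (W : finGroupType) (n : nat).
Variables (C : coxeterSystem W n) (HC : simply_laced C) (pi : 'S_n) (i0 : 'I_n).
Implicit Types (i j s t : 'I_n) (q : seq 'I_n) (u v w : W) (p g : seq nat).
Local Notation a_ i := (simple_root R i).
Local Notation s_ := (cox_s C).
Local Notation len := (cox_length C).
Local Notation inv := (inv C R).
Local Notation proj := (proj R C).

Let n_gt0 : (0 < n)%N. Proof. exact: leq_ltn_trans (ltn_ord i0). Qed.

(** The default [i0] is never returned; its existence makes [n] positive. *)
Definition residue (M : nat) : 'I_n := insubd i0 (M %% n)%N.

Definition letter (M : nat) : 'I_n := pi (residue M).

Definition unposition (M : nat) : nat * 'I_n := ((M %/ n)%N, residue M).

Lemma residueE M : residue M = (M %% n)%N :> nat.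
Proof. by rewrite /residue val_insubd ltn_mod n_gt0. Qed.

Lemma unpositionK : cancel unposition (@position n).
Proof. by move=> M; rewrite /position /= residueE -divn_eq. Qed.

Lemma positionK : cancel (@position n) unposition.
Proof.
move=> [q k]; rewrite /unposition /position /= divnMDl // divn_small // addn0.
by congr (_, _); apply: val_inj; rewrite /= residueE modnMDl modn_small.
Qed.

Lemma letter_position x : letter (position x) = pi x.2.
Proof. by rewrite /letter -[residue _]/(unposition _).2 positionK. Qed.

Lemma letter_eq M M' : (letter M == letter M') = (M == M' %[mod n])%N.
Proof. by rewrite (inj_eq perm_inj) -val_eqE /= !residueE. Qed.

(* [greedy N v p]: the lexicographically first reduced subword of [v] among the
   letters of [c^oo] with numbers at least [N] has the letter numbers [p]. *)
Inductive greedy : nat -> W -> seq nat -> Prop :=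
| greedy_nil N : greedy N 1%g [::]
| greedy_take N v p : (len (s_ (letter N) * v)%g < len v)%N ->
    greedy N.+1 (s_ (letter N) * v)%g p -> greedy N v (N :: p)
| greedy_skip N v p : (len v <= len (s_ (letter N) * v)%g)%N ->
    greedy N.+1 v p -> greedy N v p.

Lemma len_mull i w : (len (s_ i * w)%g <= (len w).+1)%N.
Proof. by rewrite -len_inv invMg cox_sV -(len_inv C w) len_mulr. Qed.

Lemma left_descent_exists w : w != 1%g -> exists i, (len (s_ i * w)%g < len w)%N.
Proof.
rewrite -eq_invg1 => /(descent_exists C) [i]; rewrite len_inv.
by rewrite -len_inv invMg invgK cox_sV => h; exists i.
Qed.

Lemma greedy_exists N v : exists p, greedy N v p.
Proof.
have [k] := ubnP (len v); elim: k N v => // k IH N v; rewrite ltnS => lv.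
have [->|/left_descent_exists [i di]] := eqVneq v 1%g.
  by exists [::]; constructor.
have [d hd] : exists d, letter (N + d)%N = i.
  (* With this [d], the number [N + d] is the position of the letter [i] in copy number [N] of
     [c]. *)
  exists (N * n.-1 + (pi^-1)%g i)%N; rewrite addnA -mulnS prednK //.
  by rewrite -[(_ * n + _)%N]/(position (N, (pi^-1)%g i)) letter_position permKV.
move: di; rewrite -{}hd; elim: d N => [|d IHd] N di.
  rewrite addn0 in di; have [p hp] := IH N.+1 _ (leq_trans di lv).
  by exists (N :: p); constructor.
have [le|lt] := leqP (len v) (len (s_ (letter N) * v)%g).
  have [|p hp] := IHd N.+1; first by rewrite addSnnS.
  by exists p; apply: greedy_skip.
have [p hp] := IH N.+1 _ (leq_trans lt lv).
by exists (N :: p); constructor.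
Qed.

Lemma greedy_spec N v p : greedy N v p ->
  [/\ sorted ltn p, all (leq N) p, size p = len v & word_val C (map letter p) = v].
Proof.
elim=> {N v p} [N|N v p d _ [so al sz wv]|N v p d _ [so al sz wv]].
- by rewrite word_val_nil len1.
- split.
  + by rewrite /= path_sortedE ?so ?andbT //; exact: ltn_trans.
  + by rewrite /= leqnn; apply: sub_all al => M /ltnW.
  + apply/eqP; rewrite /= sz eqn_leq d /= -{1}(cox_sK C (letter N) v) len_mull //.
  + by rewrite /= word_val_cons wv cox_sK.
- by split=> //; apply: sub_all al => M /ltnW.
Qed.

Lemma greedy_min N v p : greedy N v p -> forall p', sorted ltn p' -> all (leq N) p' ->
  size p' = len v -> word_val C (map letter p') = v ->
  ((p : seqlexi nat) <= (p' : seqlexi nat))%O.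
Proof.
elim=> {N v p} [N|N v p d _ IH|N v p d _ IH] p' so al sz wv.
- exact: lexi0s.
- case: p' so al sz wv => [|M p'] so al sz wv.
    by rewrite -wv word_val_nil len1 in d.
  rewrite lexi_cons; case/andP: al => NM al.
  have [e|ne] := eqVneq M N; last first.
    have lt : (N < M)%N by rewrite ltn_neqAle eq_sym ne.
    by rewrite !leEnat (ltnW lt) leqNgt lt.
  rewrite e lexx /=; apply: IH.
  + exact: path_sorted so.
  + by move: so; rewrite /= path_sortedE => [/andP [h _]|]; [rewrite -e | exact: ltn_trans].
  + have := len_mull (letter N) (s_ (letter N) * v)%g; rewrite cox_sK; move: d sz => /=.
    by move: (len _) (len _) (size _) => *; lia.
  + by rewrite -wv /= word_val_cons e cox_sK.
- apply: IH => //; case: p' so al sz wv => [|M p'] so al sz wv //.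
  have al' : all (leq M.+1) p'.
    by move: so; rewrite /= path_sortedE => [/andP []|]; last exact: ltn_trans.
  case/andP: al => NM al; rewrite leq_eqVlt in NM.
  case/orP: NM => [/eqP e|lt]; last first.
    by rewrite /= lt; apply: sub_all al' => M' /ltnW /(leq_trans lt).
  exfalso; move: d; rewrite leqNgt => /negP; apply; rewrite -wv /= word_val_cons -e cox_sK.
  have := len_le C (map letter p'); rewrite size_map => h.
  by apply: leq_ltn_trans h _; rewrite -e in wv *; rewrite -(word_val_cons C) wv -sz.
Qed.

(* [D] is the set of the letters that were skipped before the letter number [N]. *)
Definition nested (D : pred 'I_n) N g : Prop :=
  (forall M', M' \in g -> ~~ D (letter M')) /\
  (forall M M', (N <= M)%N -> M \notin g -> M' \in g -> (M < M')%N ->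
     letter M != letter M').

(** The word held by the recursion of [proj] at letter number [N]: the letters not yet discarded, in
    cyclic order. *)
Definition active (D : pred 'I_n) N : seq 'I_n :=
  [seq i <- map letter (iota N n) | ~~ D i].

Lemma letters_cons N : exists L, [/\ map letter (iota N n) = letter N :: L,
  map letter (iota N.+1 n) = rcons L (letter N) & letter N \notin L].
Proof.
have i1 m : (0 < m)%N -> iota N m = N :: iota N.+1 m.-1 by case: m.
have i2 m : (0 < m)%N -> iota N.+1 m = rcons (iota N.+1 m.-1) (N + m)%N.
  by case: m => // m _; rewrite -(addn1 m) iotaD cats1 addn1 /= addSnnS.
exists (map letter (iota N.+1 n.-1)); split.
- by rewrite i1.
- rewrite i2 // map_rcons; congr rcons.
  by apply/eqP; rewrite letter_eq modnDr.
- apply/mapP => -[M]; rewrite mem_iota => /andP [l1 l2] /eqP.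
  rewrite letter_eq eq_sym eqn_mod_dvd ?(ltnW l1) // => /dvdn_leq.
  rewrite subn_gt0 => /(_ l1) h; move: l2; rewrite addSn -addnS prednK // => l2.
  by rewrite leqNgt ltn_subLR ?(ltnW l1) // l2 in h.
Qed.

Lemma proj_1 q : proj q 1%g 1%g.
Proof.
have [v pv] := proj_exists R HC q 1%g; suff -> : 1%g = v :> W by exact: (proj_idem HC pv).
apply: (@inv_inj R _ _ _ HC) => x; rewrite (negbTE (inv1 HC x)); apply/esym/negbTE.
by apply: contra (inv1 HC x); exact: (proj_sub HC pv).
Qed.

(** Both recursions take exactly the left descents. They differ when a letter is skipped: [proj]
    discards it for good, which means adding it to [D], while [greedy] may use it again; [nested]
    says that this never happens. *)
Lemma proj_nested N v g : greedy N v g -> forall D,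
  proj (active D N) v v <-> nested D N g.
Proof.
elim=> {N v g} [N|N v p d gr IH|N v p d gr IH] D.
- by split=> _; [split | exact: proj_1].
- have [L [e1 e2 nL]] := letters_cons N; have [_ al _ _] := greedy_spec gr.
  have di : a_ (letter N) \in inv v by rewrite left_descent.
  rewrite /active e1 /=; have [DN|DN] := boolP (D (letter N)).
    split=> [pv|[h _]]; last by have := h N (mem_head _ _); rewrite DN.
    have := proj_supp HC pv di (i := letter N).
    by rewrite mem_filter DN => /(_ isT) /eqP; rewrite simple_coord1 oner_eq0.
  have aE : active D N.+1 = rcons [seq i <- L | ~~ D i] (letter N).
    by rewrite /active e2 filter_rcons DN.
  have step : proj (letter N :: [seq i <- L | ~~ D i]) v v <->
      proj (active D N.+1) (s_ (letter N) * v)%g (s_ (letter N) * v)%g.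
    rewrite aE; split=> pv.
      by have [v' vE] := proj_take_inv pv di; have -> : v' = (s_ (letter N) * v)%g by rewrite vE cox_sK.
    by rewrite -{2}(cox_sK C (letter N) v); exact: proj_take.
  rewrite step IH; split=> -[h1 h2]; split.
  + by move=> M'; rewrite inE => /orP [/eqP ->|/h1].
  + move=> M M' NM; rewrite !inE negb_or => /andP [ne Mp] /orP [/eqP ->|M'p] lt.
      by rewrite ltnNge NM in lt.
    by apply: h2 => //; rewrite ltn_neqAle eq_sym ne.
  + by move=> M' M'p; apply: h1; rewrite inE M'p orbT.
  + move=> M M' NM Mp M'p lt; apply: h2 => //; first exact: ltnW.
      by rewrite inE negb_or Mp gtn_eqF.
    by rewrite inE M'p orbT.
- have [L [e1 e2 nL]] := letters_cons N; have [_ al _ _] := greedy_spec gr.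
  have di : a_ (letter N) \notin inv v by rewrite left_descent // -leqNgt.
  have gN M' : M' \in p -> (N < M')%N by move=> /(allP al).
  have Np : N \notin p by apply/negP => /gN; rewrite ltnn.
  rewrite /active e1 /=; have [DN|DN] := boolP (D (letter N)); rewrite /=.
    have -> : [seq i <- L | ~~ D i] = active D N.+1.
      by rewrite /active e2 filter_rcons DN.
    rewrite IH; split=> -[h1 h2]; split=> // M M' NM Mp M'p lt; last exact: h2 (ltnW NM) Mp M'p lt.
    move: NM; rewrite leq_eqVlt => /orP [/eqP <-|NM]; last exact: h2.
    by apply: contraTneq (h1 _ M'p) => <-; rewrite DN.
  pose D' := [pred i | (i == letter N) || D i].
  have aE : [seq i <- L | ~~ D i] = active D' N.+1.
    rewrite /active e2 filter_rcons /= eqxx /=; apply: eq_in_filter => i iL.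
    by rewrite /= negb_or; case: eqP => // e; rewrite -e iL in nL.
  have step : proj (letter N :: [seq i <- L | ~~ D i]) v v <-> proj (active D' N.+1) v v.
    rewrite aE; split=> pv; first exact: proj_skip_inv pv di.
    exact: proj_skip.
  rewrite step IH; split=> -[h1 h2]; split.
  + by move=> M' /h1 /=; rewrite negb_or => /andP [].
  + move=> M M' NM Mp M'p lt; move: NM; rewrite leq_eqVlt => /orP [/eqP <-|NM]; last exact: h2.
    by have := h1 _ M'p; rewrite /= negb_or eq_sym => /andP [].
  + move=> M' M'p; rewrite /= negb_or h1 // andbT eq_sym.
    by apply: h2 => //; exact: gN.
  + by move=> M M' NM; apply: h2; exact: ltnW.
Qed.

Lemma active0 : active pred0 0 = cox_word pi.
Proof.
rewrite /active filter_predT -val_enum_ord -map_comp; apply: eq_map => k /=.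
by congr (pi _); apply: val_inj; rewrite /= residueE modn_small.
Qed.

Lemma subword_lettersE (p : seq (nat * 'I_n)) :
  subword_letters pi p = map letter (map (@position n) p).
Proof. by rewrite -map_comp; apply: eq_map => x /=; rewrite letter_position. Qed.

Lemma sorting_wordP v g (p : seq (nat * 'I_n)) : greedy 0 v g ->
  sorting_word C pi v p <-> map (@position n) p = g.
Proof.
move=> gr; have [so al sz wv] := greedy_spec gr.
have pg : map (@position n) (map unposition g) = g by rewrite mapK //; exact: unpositionK.
have rg : reduced_subword C pi v (map unposition g).
  by split; rewrite ?pg // /reduced subword_lettersE pg ?wv ?size_map.
have min (p' : seq (nat * 'I_n)) : reduced_subword C pi v p' ->
    ((g : seqlexi nat) <= (map (@position n) p' : seqlexi nat))%O.
  move=> [so' re' wv']; apply: (greedy_min gr) => //.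
  - by apply/allP.
  - by move: re'; rewrite /reduced wv' subword_lettersE size_map.
  - by rewrite -subword_lettersE.
split=> [[red mi]|pE].
  apply: (@le_anti _ (seqlexi nat)); rewrite (min _ red) andbT.
  by have := mi _ rg; rewrite pg.
split; last by move=> p' /min; rewrite pE.
have -> // : p = map unposition g.
by rewrite -pE mapK //; exact: positionK.
Qed.

Lemma mem_sorting_block (p : seq (nat * 'I_n)) b k :
  (pi k \in sorting_block pi p b) = ((b, k) \in p).
Proof.
rewrite inE; apply/mapP/idP => [[[b' k'] ]|h].
  by rewrite mem_filter /= => /andP [/eqP -> h] /perm_inj ->.
by exists (b, k); rewrite ?mem_filter ?eqxx.
Qed.

(** The inclusions between consecutive blocks amount to [nested] with nothing discarded at the
    start. *)
Lemma sortableP v : sortable C pi v <-> proj (cox_word pi) v v.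
Proof.
have [g gr] := greedy_exists 0 v; rewrite -active0 (proj_nested gr).
have mp (p : seq (nat * 'I_n)) x : map (@position n) p = g ->
    (x \in p) = (position x \in g).
  by move=> <-; rewrite mem_map //; exact: can_inj positionK.
split=> [[p /(sorting_wordP p gr) pg ne]|[_ ne]].
  split=> // M M' _ Mg M'g lt; apply: contra Mg => /eqP e.
  rewrite -[M]unpositionK -(mp p) //.
  have eM : residue M = residue M' by exact: perm_inj e.
  have : (M %/ n <= M' %/ n)%N by rewrite leq_div2r // ltnW.
  have : ((M' %/ n)%N, residue M) \in p.
    by rewrite (mp p) // eM -[(_, _)]/(unposition M') unpositionK.
  (* The letter is followed from the copy of [c] containing [M'] down, one copy at a time, to the
     one containing [M]. *)
  rewrite /unposition; move: (M' %/ n)%N => b; elim: b => [|b IH] h.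
    by rewrite leqn0 => /eqP ->.
  rewrite leq_eqVlt ltnS => /orP [/eqP -> //|]; apply: IH.
  by have /subsetP /(_ (pi (residue M))) := ne b; rewrite !mem_sorting_block; apply.
exists (map unposition g); first by apply/(sorting_wordP _ gr); rewrite mapK //; exact: unpositionK.
have pg : map (@position n) (map unposition g) = g by rewrite mapK //; exact: unpositionK.
move=> b; apply/subsetP => i; rewrite -(permKV pi i) !mem_sorting_block !(mp _ _ pg).
set k := (pi^-1)%g i => h; apply: contraT => nh.
have := ne _ _ (leq0n _) nh h; rewrite !letter_position eqxx; apply.
by rewrite /position /= mulSn -addnA -[X in (X < _)%N]add0n ltn_add2r.
Qed.

End SortingWords.

Theorem mainTheorem6 (R : realFieldType) (W : finGroupType) (n : nat)
  (C : coxeterSystem W n) (HC : simply_laced C)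
  (c : W) (pi : 'S_n) (Hc : c = word_val C (cox_word pi))
  (w : W) (t : 'I_n) (Hcov : covers C w t) :
  cambrian_congr C pi R (w * cox_s C t)%g w <-> ~ c_stable C R pi w t.
Proof.
have uq := uniq_cox_word pi; have [v pv] := proj_exists R HC (cox_word pi) w.
(* The letter [t] is passed as the witness that [n] is positive. *)
have sv : sortable C pi v by apply/(sortableP R HC pi t); exact: (proj_idem HC pv).
have vmax v' : sortable C pi v' -> weak_le C R v' w -> weak_le C R v' v.
  by move=> /(sortableP R HC pi t) pv' le; exact: (proj_max HC uq pv pv').
have subw : {subset inv C R (w * cox_s C t)%g <= inv C R w}.
  by move=> x; rewrite mem_inv_cover // => /andP [].
set b := - act C w (simple_root R t).
have stab : c_stable C R pi w t <-> b \in inv C R v.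
  rewrite c_stableP //; split=> [st|bv x y px py xy o].
    by apply: (stable_label HC uq Hcov _ st pv); exact: supp_cox_word.
  apply: (proj_sub HC pv); apply: (proj_aligned HC pv uq (y := y)) => //.
  by rewrite xy.
(* If the cover is contracted, [v] lies below [w * s_ t], which does not have the inversion [b].
   Conversely, if [b] is not an inversion of [v], then [v] still lies below [w * s_ t] and is
   largest there too. *)
rewrite stab; split=> [[v1 [s1 l1 _] [_ l2 m2]] bv|/negP nb].
  have := l1 b (m2 v sv (proj_sub HC pv) b bv).
  by rewrite mem_inv_cover // eqxx andbF.
exists v; last by split=> //; exact: (proj_sub HC pv).
split=> // [x xv|v' sv' le]; last by apply: vmax => // x /le /subw.
rewrite mem_inv_cover // (proj_sub HC pv) //=.
by apply: contraNneq nb => e; rewrite /b -e.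
Qed.
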